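(* Let $k\geq 1$ and $n>2k$ be integers. There exists a non-bipartite graph $G$ that is a quadrangulation of the real projective space $P^{n-2k}$ and admits a graph homomorphism to the Schrijver graph $SG(n,k)$.
   Context: A generalised simplicial complex $K$ is a space built inductively from a finite set of points by attaching, at step $i$, finitely many $i$-simplices via gluing maps that map the interior of each boundary face homeomorphically onto the interior of a cell of the same dimension (several simplices may share a vertex set). A quadrangulation of $K$ is a spanning subgraph $G$ of the $1$-skeleton of $K$ such that the vertex set of every inclusionwise maximal simplex of $K$ induces in $G$ a complete bipartite subgraph with at least one edge; if the underlying space $\|K\|$ is homeomorphic to $X$, $G$ is a quadrangulation of $X$. The Schrijver graph $SG(n,k)$ has as vertices the $k$-element subsets of $[n]=\{1,\dots,n\}$ that are independent in the cycle $C_n$ with edges $12,23,\dots,(n-1)n,n1$ (i.e. contain no two cyclically consecutive elements), two vertices being adjacent iff the sets are disjoint. A homomorphism $G\to H$ is a map $f:V(G)\to V(H)$ with $f(u)f(v)\in E(H)$ whenever $uv\in E(G)$. *)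

(* Defs.v *)
From HB Require Import structures.
From mathcomp Require Import all_boot all_order all_algebra.
From mathcomp Require Import all_classical reals topology normedtype.

Set Implicit Arguments.
Unset Strict Implicit.
Unset Printing Implicit Defensive.

Import Order.TTheory GRing.Theory Num.Theory.
Import numFieldNormedType.Exports.

Definition simple_graph (T : finType) (e : rel T) : Prop :=
  symmetric e /\ irreflexive e.

Definition bipartite (T : finType) (e : rel T) : Prop :=
  exists c : T -> bool, forall u v, e u v -> c u != c v.

Definition graph_hom (T U : finType) (e : rel T) (e' : rel U) (f : T -> U) :
  Prop := forall u v, e u v -> e' (f u) (f v).

(* A or B may be empty, in which case there are no edges inside S. *)
Definition induces_complete_bipartite (T : finType) (e : rel T) (S : {set T}) :
  Prop :=
  exists A B : {set T},
    [/\ A :|: B = S, [disjoint A & B] &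
        {in S &, forall u v,
           e u v = (u \in A) && (v \in B) || (u \in B) && (v \in A)}].

(* Here [n] is {0, ..., n-1}, and ordS i is i + 1 modulo n. *)
Definition stable (n : nat) (A : {set 'I_n}) : bool :=
  [forall i in A, ordS i \notin A].

Definition schrijver_vertex (n k : nat) : finType :=
  {A : {set 'I_n} | (#|A| == k) && stable A}.

Definition schrijver (n k : nat) : rel (schrijver_vertex n k) :=
  fun A B => [disjoint val A & val B].

Local Open Scope classical_set_scope.
Local Open Scope ring_scope.
Local Open Scope quotient_scope.

Definition homeomorphic (X Y : topologicalType) : Prop :=
  exists (f : X -> Y) (g : Y -> X),
    [/\ continuous f, continuous g, cancel f g & cancel g f].

Definition homeo_between (X Y : topologicalType) (A : set X) (B : set Y)
    (f : X -> Y) : Prop :=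
  [/\ set_bij A B f, {within A, continuous f} &
      exists g : Y -> X, {in A, cancel f g} /\ {within B, continuous g}].

Section projective_space.
Variables (R : realType) (m : nat).

Definition sphere : set 'rV[R]_m.+1 := [set x | \sum_i x 0 i ^+ 2 = 1].

Definition antipodal_rel (x y : sphere) : bool :=
  (val x == val y) || (val x == - val y).

Lemma antipodal_rel_refl : reflexive antipodal_rel.
Proof. by move=> x; rewrite /antipodal_rel eqxx. Qed.

Lemma antipodal_rel_sym : symmetric antipodal_rel.
Proof.
by move=> x y; rewrite /antipodal_rel eq_sym; congr orb; rewrite eq_sym eqr_oppLR.
Qed.

Lemma antipodal_rel_trans : transitive antipodal_rel.
Proof.
move=> y x z; rewrite /antipodal_rel => /orP[]/eqP-> /orP[]/eqP->;
by rewrite ?opprK ?eqxx ?orbT.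
Qed.

Definition antipodal :=
  EquivRel _ antipodal_rel_refl antipodal_rel_sym antipodal_rel_trans.

Definition projective_space := {eq_quot antipodal}.

HB.instance Definition _ :=
  Topological.copy projective_space (quotient_topology projective_space).
HB.instance Definition _ := Quotient.on projective_space.

End projective_space.
Arguments sphere : clear implicits.

Section simplex.
Variables (R : realType) (d : nat).

Definition simplex : set 'rV[R]_d.+1 :=
  [set t | (forall j, 0 <= t 0 j) /\ \sum_j t 0 j = 1].

(* The relative interior of the face spanned by the corners in F. *)
Definition open_face (F : {set 'I_d.+1}) : set simplex :=
  [set t | forall j, (0 < (val t : 'rV[R]_d.+1) 0 j) = (j \in F)].

Definition simplex_interior : set simplex :=
  [set t | forall j, 0 < (val t : 'rV[R]_d.+1) 0 j].

Definition simplex_boundary : set simplex := ~` simplex_interior.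

End simplex.
Arguments simplex : clear implicits.
Arguments open_face : clear implicits.
Arguments simplex_interior : clear implicits.
Arguments simplex_boundary : clear implicits.

Record cell_space (R : realType) := CellSpace {
  underlying_space : topologicalType;
  cell : finType;
  cdim : cell -> nat;
  char_map : forall c : cell, simplex R (cdim c) -> underlying_space
}.

Definition points (R : realType) (V : finType) : cell_space R :=
  @CellSpace R (discrete_topology V) V (fun=> 0%N) (fun v _ => v).

(* Adjunction of a family of d-simplices indexed by I along maps defined on
   their boundaries; only the restriction of phi j to the boundary matters. *)
Section attach.
Variables (R : realType) (K : cell_space R) (d : nat) (I : finType).
Variable phi : I -> simplex R d -> underlying_space K.

Definition attach_summand (o : option I) : topologicalType :=
  if o is Some _ then (simplex R d : topologicalType) else underlying_space K.

Definition attach_sum := {o : option I & attach_summand o}.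

Definition in_old (x : underlying_space K) : attach_sum :=
  existT attach_summand None x.
Definition in_new (j : I) (t : simplex R d) : attach_sum :=
  existT attach_summand (Some j) t.

(* Sends a boundary point t of the j-th simplex to phi j t, and fixes every
   other point; its fibres are the classes of the relation generated by
   t ~ phi j t. *)
Definition glue (p : attach_sum) : attach_sum :=
  match p with
  | existT o x =>
    match o return attach_summand o -> attach_sum with
    | None => fun x => in_old x
    | Some j => fun t : simplex R d =>
        if t \in simplex_boundary R d then in_old (phi j t) else in_new j t
    end x
  end.

Definition attach_rel_fun (p q : attach_sum) : bool := glue p == glue q.

Lemma attach_rel_refl : reflexive attach_rel_fun.
Proof. by move=> p; rewrite /attach_rel_fun. Qed.

Lemma attach_rel_sym : symmetric attach_rel_fun.
Proof. by move=> p q; rewrite /attach_rel_fun eq_sym. Qed.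

Lemma attach_rel_trans : transitive attach_rel_fun.
Proof. by move=> q p r; rewrite /attach_rel_fun => /eqP-> /eqP->. Qed.

Definition attach_rel :=
  EquivRel _ attach_rel_refl attach_rel_sym attach_rel_trans.

Definition attach_space := {eq_quot attach_rel}.

HB.instance Definition _ :=
  Topological.copy attach_space (quotient_topology attach_space).
HB.instance Definition _ := Quotient.on attach_space.

Definition attach_cdim (c : cell K + I) : nat :=
  match c with inl c => cdim c | inr _ => d end.

Definition attach_char_map (c : cell K + I) :
    simplex R (attach_cdim c) -> attach_space :=
  match c return simplex R (attach_cdim c) -> attach_space with
  | inl c => fun t => \pi_attach_space (in_old (char_map t))
  | inr j => fun t => \pi_attach_space (in_new j t)
  end.

Definition attach : cell_space R := CellSpace attach_char_map.

End attach.

Section complexes.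
Variable R : realType.
Implicit Type K : cell_space R.

Definition open_cell K (c : cell K) : set (underlying_space K) :=
  @char_map R K c @` simplex_interior R (cdim c).

Definition closed_simplex K (c : cell K) : set (underlying_space K) :=
  range (@char_map R K c).

(* A face spanned by #|F| corners has dimension #|F| - 1; nonempty proper F
   give the faces in the boundary. *)
Definition gluing_map K (d : nat) (f : simplex R d -> underlying_space K) : Prop :=
  {within simplex_boundary R d, continuous f} /\
  forall F : {set 'I_d.+1}, F != finset.set0 -> F != [set: 'I_d.+1]%SET ->
    exists c : cell K,
      (cdim c).+1 = #|F| /\ homeo_between (open_face R d F) (open_cell c) f.

Inductive built_up_to : nat -> cell_space R -> Prop :=
| built_points (V : finType) : built_up_to 0 (points R V)
| built_attach (i : nat) K (I : finType)
    (phi : I -> simplex R i.+1 -> underlying_space K) :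
    built_up_to i K -> (forall j, gluing_map (phi j)) ->
    built_up_to i.+1 (attach phi).

Definition generalised_simplicial_complex K : Prop :=
  exists i, built_up_to i K.

Definition maximal_simplex K (c : cell K) : Prop :=
  forall c' : cell K,
    closed_simplex c `<=` closed_simplex c' ->
    closed_simplex c' = closed_simplex c.

Definition vertex K : finType := {c : cell K | cdim c == 0%N}.

Definition vertex_set K (c : cell K) : {set vertex K} :=
  finset.finset
    (fun v : vertex K => `[< closed_simplex (val v) `<=` closed_simplex c >]).

Definition skeleton_adjacent K (u v : vertex K) : Prop :=
  exists c : cell K, cdim c = 1%N /\ vertex_set c = [set u; v]%SET.

Definition quadrangulation K (G : rel (vertex K)) : Prop :=
  [/\ simple_graph G,
      (forall u v, G u v -> skeleton_adjacent u v) &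
      forall c : cell K, maximal_simplex c ->
        induces_complete_bipartite G (vertex_set c) /\
        exists u v, [/\ u \in vertex_set c, v \in vertex_set c & G u v]].

End complexes.

(* Main.v *)
(* Subdivide the boundary of the box prod_i [0, M_i] in R^(m+1), m = n - 2k, by the order
   (Freudenthal) triangulation and centre it at the origin.  Radial projection makes it an
   antipodally symmetric triangulation of S^m, hence a generalised simplicial complex on
   P^m.  If sum_i M_i is odd, the parity of the coordinate sum is an antisymmetric
   2-colouring for which no maximal simplex is monochromatic, so the bichromatic edges
   quadrangulate P^m; a 2-colouring of the quotient graph would make an invariant that is
   constant along a grid path from 0 to M yet differs at the antipodes 0 and M.

   For the homomorphism, apply the difference operator 2k - 1 times to the coordinates of a
   vertex v, extended by zero, to get y(v) in Z^n.  By a quantitative form of Descartes'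
   rule of signs, if the M_i are large then y(v) alternates in sign at least 2k times with
   entries exceeding 2^(2k-1), so its large positive entries contain a stable k-set, the
   label of v.  For adjacent u and -v the sum y(u) + y(v) has entries at most 2^(2k), so
   the labels of u and v are disjoint. *)

From HB Require Import structures.
Require Import Defs.
From mathcomp Require Import all_boot all_order all_algebra.
From mathcomp Require Import all_classical reals topology normedtype realfun.
From mathcomp Require Import zify ring lra.

Set Implicit Arguments.
Unset Strict Implicit.
Unset Printing Implicit Defensive.
Import Order.TTheory GRing.Theory Num.Theory.
Import numFieldNormedType.Exports.
Local Open Scope classical_set_scope.
Local Open Scope ring_scope.
Local Open Scope quotient_scope.

(** The count 2k - 1 comes from two balances. A vertex of the box boundary has m + 1 coordinates,
    one of which equals plus or minus M_i: one large entry. Each difference lengthens the sequence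
    by one and adds one alternating entry, so 2k - 1 of them give length n and 2k entries. Each also
    multiplies an error bound by at most 2, which turns the distance 2 between u and the antipode of
    v into 2^(2k); two entries above 2^(2k-1) exceed this, whence the threshold. A vertex of the
    quotient is represented by the even member of its antipodal pair, so an edge of the graph is a
    simplex made of one even representative and the antipode of another. Sides of length at least 3
    keep antipodes from having a common neighbour, so no further edges appear inside a simplex. The
    complex has to be built by successive gluing. Each skeleton therefore carries an embedding into
    the Hausdorff target, along which the characteristic maps are pulled back to give the next
    gluing maps. Points are written in cone coordinates; since a line forgets scale, radial
    projection never has to be computed. *)

(** * Attaching simplices along a cellulation *)

(** A closed set of the compact source has compact, hence closed, image, and such images are the
    preimages of closed sets under [g]. *)
Lemma compact_injective_inverse (S X : topologicalType) (f : S -> X) (s0 : S) :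
  compact [set: S] -> hausdorff_space X -> continuous f -> injective f ->
  exists g : X -> S, cancel f g /\ {within range f, continuous g}.
Proof.
move=> cS hX cf fI.
have [g fK] : exists g, cancel f g.
  exists (fun x => xget s0 [set s | f s = x]) => s.
  by case: xgetP => [y _ /fI//|/(_ s)/=].
exists g; split=> //; apply/continuous_closedP => Z cZ.
apply/closed_subspaceP; exists (f @` Z).
  apply: compact_closed => //; apply: continuous_compact.
    exact: continuous_subspaceT.
  exact: subclosed_compact cS _.
apply/seteqP; split=> [x [[s Zs <-] _]|x [Zg [s _ sx]]].
  split; last by exists s.
  by change (Z (g (f s))); rewrite fK.
split; last by exists s.
by exists s => //; rewrite -(fK s) sx.
Qed.

Lemma separated_hausdorff (R : realType) (X : topologicalType) :
  (forall x y : X, x <> y -> exists f : X -> R, continuous f /\ f x <> f y) ->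
  hausdorff_space X.
Proof.
move=> sep; rewrite open_hausdorff => x y /eqP xy.
have [f [cf fxy]] := sep _ _ xy.
have := @Rhausdorff R; rewrite open_hausdorff => /(_ (f x) (f y)).
case=> [|[A B] /= [fA fB] [oA oB AB]]; first exact/eqP.
exists (f @^-1` A, f @^-1` B) => /=; first by rewrite !inE in fA fB *.
split; [by apply: open_comp => // ? _; exact: cf..|].
by rewrite -preimage_setI (eqP AB) preimage_set0.
Qed.

Lemma sum_continuous (R : realType) (T : topologicalType) (V : normedModType R)
    (I : Type) (r : seq I) (F : I -> T -> V) :
  (forall i, continuous (F i)) -> continuous (fun t => \sum_(i <- r) F i t).
Proof.
move=> cF; elim: r => [|i r IH] t.
  by rewrite (_ : (fun _ => _) = fun=> 0); [exact: cvg_cst|apply/funext => ?;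
    rewrite big_nil].
rewrite (_ : (fun _ => _) = F i \+ fun t => \sum_(i <- r) F i t); last first.
  by apply/funext => ?; rewrite big_cons.
by apply: cvgD; [exact: cF|exact: IH].
Qed.

Lemma simplex_coord_continuous (R : realType) d (j : 'I_d.+1) :
  continuous (fun t : simplex R d => (val t : 'rV[R]_d.+1) 0 j).
Proof.
move=> t; apply: (@continuous_comp _ _ _ (fun t : simplex R d => val t)
  (fun M : 'rV[R]_d.+1 => M 0 j)); last exact: coord_continuous.
exact: initial_continuous.
Qed.

Lemma simplex_compact (R : realType) d : compact [set: simplex R d].
Proof.
have cp : compact (simplex R d).
  apply: (@subclosed_compact 'rV[R]_d.+1 (simplex R d) [set t : 'rV[R]_d.+1 | forall j,
    `[0, 1]%classic (t ord0 j)]).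
  - rewrite (_ : simplex R d =
      (\bigcap_j ((fun t : 'rV[R]_d.+1 => t 0 j) @^-1` [set x | 0 <= x])) `&`
      (fun t : 'rV[R]_d.+1 => \sum_j t 0 j) @^-1` [set x | x = 1]); last first.
      apply/seteqP; split=> [t [t0 t1]|t [t0 t1]]; split=> // j.
        by move=> _; exact: (t0 j).
      exact: (t0 j).
    apply: closedI.
      apply: closed_bigI => j _.
      apply: preimage_closed; last exact: closed_ge.
      by move=> t _; exact: coord_continuous.
    apply: preimage_closed; last exact: closed_eq.
    by move=> t _; apply: (sum_continuous (F := fun j (t : 'rV[R]_d.+1) => t 0 j)) => j;
      exact: coord_continuous.
  - by apply: (@rV_compact R _ (fun=> `[0, 1]%classic)) => _; exact: segment_compact.
  - move=> t [t0 t1] j /=; rewrite in_itv/= t0/= -t1 (bigD1 j)//= lerDl.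
    exact: sumr_ge0.
have [t0 t0S] : exists t, simplex R d t.
  exists (\row_j (j == 0)%:R); split=> [j|]; first by rewrite mxE ler0n.
  by rewrite (bigD1 0)//= mxE big1 ?addr0// => j /negPf j0; rewrite mxE j0.
pose s0 : simplex R d := SigSub (mem_set t0S).
(* Compactness passes from the subset of the ambient space to the subtype as the image under the
   partial inverse of [val]. *)
have -> : [set: simplex R d] = valL_ s0 id @` simplex R d.
  apply/seteqP; split=> // s _; exists (val s); first exact: set_valP.
  by have := @valLK _ _ s0 (simplex R d) id => /(congr1 (fun f => f s)).
apply: continuous_compact => //.
by apply/subspace_valL_continuousP' => s.
Qed.

Lemma simplex_interior_nonempty (R : realType) d :
  exists t, simplex_interior R d t.
Proof.
have tS : simplex R d (const_mx d.+1%:R^-1).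
  split=> [j|]; first by rewrite mxE invr_ge0.
  rewrite (eq_bigr (fun=> d.+1%:R^-1)) => [|j _]; last by rewrite mxE.
  by rewrite sumr_const card_ord -[LHS]mulr_natr mulVf// pnatr_eq0.
exists (SigSub (mem_set tS)) => j /=.
by rewrite mxE invr_gt0 ltr0n.
Qed.

Lemma within_comp (S T U : topologicalType) (A : set S) (B : set T)
    (f : S -> T) (g : T -> U) :
  {within A, continuous f} -> {within B, continuous g} -> f @` A `<=` B ->
  {within A, continuous (g \o f)}.
Proof.
move=> /subspace_continuousP cf /subspace_continuousP cg AB.
apply/subspace_continuousP => x Ax W nW.
have Bfx : B (f x) by apply: AB; exists x.
have /cf := cg _ Bfx _ nW; move=> /(_ Ax); rewrite /nbhs/= /within/=.
by apply: filterS => y + Ay; apply=> //; apply: AB; exists y.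
Qed.

(** * Building a cellulated space skeleton by skeleton *)

Section skeleta.
Variables (R : realType) (X : topologicalType) (C : nat -> finType).
Variable chi : forall d, C d -> simplex R d -> X.
Hypothesis hX : hausdorff_space X.
Hypothesis chi_cont : forall d (c : C d), continuous (chi c).
Hypothesis chi_inj : forall d (c : C d), injective (chi c).
Hypothesis chi_face : forall d (c : C d) (F : {set 'I_d.+1}),
  F != finset.set0 -> exists d' (c' : C d'),
    d'.+1 = #|F| /\ chi c @` open_face R d F = chi c' @` simplex_interior R d'.
Hypothesis chi_disj : forall d d' (c : C d) (c' : C d') t t',
  simplex_interior R d t -> simplex_interior R d' t' -> chi c t = chi c' t' ->
  Tagged C c = Tagged C c'.

(** The induction invariant: [h] embeds [K] in [X] as the union of the cells of dimension at most
    [i], and [e] names the cell of [X] that a cell of [K] realises. Compactness is kept so that the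
    inverse of [h] is continuous on its range. *)
Record skeleton (i : nat) (K : cell_space R) (h : underlying_space K -> X)
    (e : cell K -> {d & C d}) : Prop := Skeleton {
  skel_compact : compact [set: underlying_space K];
  skel_cont : continuous h;
  skel_inj : injective h;
  skel_dim : forall c, tag (e c) = cdim c;
  skel_open : forall c, h @` open_cell c =
    chi (tagged (e c)) @` simplex_interior R (tag (e c));
  skel_closed : forall c, h @` closed_simplex c = range (chi (tagged (e c)));
  skel_cells_inj : injective e;
  skel_cells : forall x, (tag x <= i)%N <-> exists c, e c = x;
  skel_cover : forall x : underlying_space K, exists c : cell K, open_cell c x }.

Lemma boundary_face d (t : simplex R d) : simplex_boundary R d t ->
  exists F : {set 'I_d.+1}, [/\ F != finset.set0, F != [set: 'I_d.+1]%SET &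
    open_face R d F t].
Proof.
move=> bt; exists [set j | 0 < (val t : 'rV[R]_d.+1) 0 j]%SET.
have [t0 t1] := set_valP t; split; last by move=> j; rewrite inE.
  apply/eqP => /setP F0; have /eqP := t1; rewrite big1 ?(eq_sym 0) ?oner_eq0// => j _.
  by apply/eqP; have := F0 j; rewrite !inE lt0r t0 andbT => /negbFE.
by apply/eqP => /setP FT; apply: bt => j; have := FT j; rewrite !inE.
Qed.

Lemma open_face_boundary d (F : {set 'I_d.+1}) : F != [set: 'I_d.+1]%SET ->
  open_face R d F `<=` simplex_boundary R d.
Proof.
move=> FT t tF ti; case/negP: FT; apply/eqP/setP => j.
by rewrite inE -tF; exact: ti.
Qed.

Section step.
Variables (i : nat) (K : cell_space R) (h : underlying_space K -> X).
Variable e : cell K -> {d & C d}.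
Hypothesis sk : skeleton i h e.

(** A proper face has at most i + 1 corners, so the cell it is mapped onto has dimension at most [i]
    and is already in [K]. *)
Lemma boundary_in_skeleton (j : C i.+1) (F : {set 'I_i.+2}) :
  F != finset.set0 -> F != [set: 'I_i.+2]%SET ->
  exists c : cell K, (cdim c).+1 = #|F| /\
    chi j @` open_face R i.+1 F = h @` open_cell c.
Proof.
move=> F0 FT; have [d [c' [dF cF]]] := chi_face j F0.
have di : (d <= i)%N.
  rewrite -ltnS dF -ltnS -[X in (_ < X)%N](card_ord i.+2) -cardsT proper_card//.
  by rewrite finset.properEneq FT finset.subsetT.
have [c ec] : exists c, e c = Tagged C c' by apply/(skel_cells sk).
by exists c; rewrite -(skel_dim sk) (skel_open sk) ec cF.
Qed.

(** The gluing map is the inverse of [h] after [chi j], which makes sense on the boundary because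
    every proper face lands in the range of [h]. Its inverse on an open face is the inverse of
    [chi j] after [h]. *)
Lemma gluing_exists : exists phi : C i.+1 -> simplex R i.+1 -> underlying_space K,
  (forall j, gluing_map (phi j)) /\
  (forall j t, simplex_boundary R i.+1 t -> h (phi j t) = chi j t).
Proof.
(* Inverting [h] takes a base point. If [K] has no point, then [C i.+1] is empty, since a corner of
   one of its simplices would be a cell of [K]. *)
have [[s0 _]|K0] := pselect (exists s : underlying_space K, True); last first.
  have C0 (j : C i.+1) : False.
    have F0 : [set ord0]%SET != finset.set0 :> {set 'I_i.+2}.
      by rewrite -card_gt0 cards1.
    have [|c _] := boundary_in_skeleton j F0.
      by apply/eqP => /setP/(_ ord_max); rewrite !inE.
    have [t _] := simplex_interior_nonempty R (cdim c).
    by apply: K0; exists (char_map t).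
  by exists (fun j => False_rect _ (C0 j)); split=> j; case: (C0 j).
have [g [hK cg]] := compact_injective_inverse s0 (skel_compact sk) hX
  (skel_cont sk) (@skel_inj _ _ _ _ sk).
have bdry j : chi j @` simplex_boundary R i.+1 `<=` range h.
  move=> _ [t /boundary_face[F [F0 FT tF]] <-].
  have [c [_ cF]] := boundary_in_skeleton j F0 FT.
  have : (chi j @` open_face R i.+1 F) (chi j t) by exists t.
  by rewrite cF => -[x _ <-]; exists x.
have hphi j t : simplex_boundary R i.+1 t -> h (g (chi j t)) = chi j t.
  move=> bt; have [|x _ <-] := bdry j (chi j t); first by exists t.
  by rewrite hK.
exists (fun j => g \o chi j); split=> [j|//].
have cphi : {within simplex_boundary R i.+1, continuous (g \o chi j)}.
  by apply: within_comp cg (bdry j); exact/continuous_subspaceT/chi_cont.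
split=> // F F0 FT; have [c [dc cF]] := boundary_in_skeleton j F0 FT.
have bF := open_face_boundary FT.
exists c; split=> //; split.
- split.
  + move=> t tF /=.
    have : (chi j @` open_face R i.+1 F) (chi j t) by exists t.
    by rewrite cF => -[x cx xt]; rewrite -xt hK.
  + move=> s t; rewrite !inE => sF tF /(congr1 h)/=.
    by rewrite (hphi _ _ (bF _ sF)) (hphi _ _ (bF _ tF)); exact: chi_inj.
  + move=> x cx; have : (h @` open_cell c) (h x) by exists x.
    by rewrite -cF => -[t tF tx]; exists t; rewrite //= tx hK.
- exact: continuous_subspaceW cphi.
have [s _] := simplex_interior_nonempty R i.+1.
have [r [chiK cr]] := compact_injective_inverse s (@simplex_compact _ _) hX
  (@chi_cont _ j) (@chi_inj _ j).
exists (r \o h); split.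
  by move=> t; rewrite inE => tF /=; rewrite hphi ?chiK//; exact: bF.
apply: within_comp cr _; first exact/continuous_subspaceT/(skel_cont sk).
by rewrite -cF => _ [t _ <-]; exists t.
Qed.

Variable phi : C i.+1 -> simplex R i.+1 -> underlying_space K.
Hypothesis phi_chi : forall j t, simplex_boundary R i.+1 t -> h (phi j t) = chi j t.

Definition attach_sum_map (p : attach_sum K i.+1 (C i.+1)) : X :=
  match p with
  | existT o x =>
    match o return attach_summand K i.+1 o -> X with
    | None => fun x => h x
    | Some j => fun t => chi j t
    end x
  end.

Definition attach_map (x : underlying_space (attach phi)) : X :=
  attach_sum_map (repr (x : attach_space phi)).

Definition attach_label (c : cell (attach phi)) : {d & C d} :=
  match c with inl c => e c | inr j => Tagged C j end.

Lemma attach_sum_map_glue p : attach_sum_map (Defs.glue phi p) = attach_sum_map p.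
Proof.
case: p => [[j|] x] //=; case: ifPn => //.
by move=> bx; apply: phi_chi; exact: set_mem bx.
Qed.

Lemma attach_mapE p : attach_map (\pi_(attach_space phi) p) = attach_sum_map p.
Proof.
rewrite /attach_map -attach_sum_map_glue -[RHS]attach_sum_map_glue.
by have /eqmodP/eqP -> : repr (\pi_(attach_space phi) p) = p %[mod attach_space phi]
  by rewrite reprK.
Qed.

(** An old point lies in an open cell of dimension at most [i], and open cells with different labels
    are disjoint. *)
Lemma attach_old_new x j t : simplex_interior R i.+1 t -> h x <> chi j t.
Proof.
move=> ti hx; have [c cx] := skel_cover sk x.
have : (h @` open_cell c) (h x) by exists x.
rewrite (skel_open sk) => -[s si sx].
have := chi_disj si ti (etrans sx hx).
move=> /(congr1 tag)/= tc.
have : (tag (e c) <= i)%N by apply/(skel_cells sk); exists c.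
by rewrite tc ltnn.
Qed.

Lemma attach_pointP (x : attach_space phi) :
  (exists y, x = \pi_(attach_space phi) (in_old i.+1 (C i.+1) y)) \/
  exists j t, simplex_interior R i.+1 t /\ x = \pi_(attach_space phi) (in_new K j t).
Proof.
rewrite -[x]reprK; case: (repr x) => [[j|] z]; last by left; exists z.
have [iz|bz] := pselect (simplex_interior R i.+1 z); first by right; exists j, z.
left; exists (phi j z); apply/eqmodP; rewrite /= /attach_rel_fun /=.
by rewrite (_ : z \in _) // inE.
Qed.

Lemma attach_map_inj : injective attach_map.
Proof.
move=> x y; case: (attach_pointP x) => [[x' ->]|[j [s [si ->]]]];
case: (attach_pointP y) => [[y' ->]|[j' [s' [si' ->]]]]; rewrite !attach_mapE /=.
- by move=> /(skel_inj sk) ->.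
- by move=> /attach_old_new; case.
- by move=> /esym/attach_old_new; case.
- move=> jj'; have jE : j = j'.
    by have /eqP := chi_disj si si' jj'; rewrite eq_Tagged => /eqP.
  by move: jj'; rewrite jE => /chi_inj ->.
Qed.

Lemma attach_skeleton : skeleton i.+1 attach_map attach_label.
Proof.
have mapE (c : cell K) (t : simplex R (cdim c)) :
    attach_map (@char_map R (attach phi) (inl c) t) = h (@char_map R K c t).
  by rewrite /= attach_mapE.
have mapE' j t : attach_map (@char_map R (attach phi) (inr j) t) = chi j t.
  by rewrite /= attach_mapE.
have pic : continuous (\pi_(attach_space phi) : attach_sum K i.+1 (C i.+1) ->
  underlying_space (attach phi)).
  exact: (@pi_continuous _ (attach_space phi)).
split.
- have -> : [set: underlying_space (attach phi)] =
      (\pi_(attach_space phi) : attach_sum K i.+1 (C i.+1) -> underlying_space (attach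
        phi)) @` setT.
    apply/seteqP; split=> // x _; exists (repr (x : attach_space phi)) => //.
    exact: reprK.
  apply: continuous_compact; first exact: continuous_subspaceT.
  apply: sigT_compact => [|[j|]]; first exact: finite_finset.
    exact: simplex_compact.
  exact: (skel_compact sk).
- apply/(@quotient_continuous _ (attach_space phi)).
  rewrite (_ : _ \o _ = attach_sum_map); last by apply/funext => p; exact: attach_mapE.
  rewrite (_ : attach_sum_map = unstable.sigT_fun (fun o : option (C i.+1) =>
    match o return attach_summand K i.+1 o -> X with
    | None => fun x => h x
    | Some j => fun t => chi j t
    end)); last by apply/funext => -[[]].
  apply: sigT_continuous => -[j|]; [exact: chi_cont|exact: (skel_cont sk)].
- exact: attach_map_inj.
- by case=> [c|j] //=; exact: (skel_dim sk).
- case=> [c|j].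
    rewrite -(skel_open sk) /open_cell !image_comp.
    by apply: eq_imagel => t _ /=; rewrite -mapE.
  by rewrite /open_cell image_comp; apply: eq_imagel => t _; rewrite -mapE'.
- case=> [c|j].
    rewrite -(skel_closed sk) /closed_simplex !image_comp.
    by apply: eq_imagel => t _ /=; rewrite -mapE.
  by rewrite /closed_simplex image_comp; apply: eq_imagel => t _; rewrite -mapE'.
- have lt c : (tag (e c) <= i)%N by apply/(skel_cells sk); exists c.
  case=> [c|j] [c'|j'] //=.
  + by move=> /(skel_cells_inj sk) ->.
  + by move=> /(congr1 tag)/= cj; have := lt c; rewrite cj ltnn.
  + by move=> /(congr1 tag)/= cj; have := lt c'; rewrite -cj ltnn.
  + by move=> /eqP; rewrite eq_Tagged => /eqP/= ->.
- move=> x; split=> [|[[c|j] <-] //=]; last first.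
    by apply: leqW; apply/(skel_cells sk); exists c.
  case: x => d c /=; rewrite leq_eqVlt => /predU1P[dE|di].
    by move: c; rewrite dE => j; exists (inr j).
  have [c' c'E] : exists c', e c' = existT _ d c by apply/(skel_cells sk).
  by exists (inl c').
- move=> x; case: (attach_pointP x) => [[y ->]|[j [t [ti ->]]]].
    by have [c [t ti <-]] := skel_cover sk y; exists (inl c), t.
  by exists (inr j), t.
Qed.

End step.

Lemma points_skeleton : exists (h : underlying_space (points R (C 0)) -> X)
    (e : cell (points R (C 0)) -> {d & C d}), skeleton 0 h e.
Proof.
have [t0 ti0] := simplex_interior_nonempty R 0.
have t0E (t : simplex R 0) : t = t0.
  apply/val_inj/rowP => j; rewrite ord1.
  have [_] := set_valP t; have [_] := set_valP t0.
  by rewrite !big_ord1 => <-.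
pose h (v : underlying_space (points R (C 0))) := chi (v : C 0) t0.
exists h, (Tagged C); split=> //.
- apply: finite_compact; exact: (@finite_finset (C 0)).
- move=> v W /nbhs_singleton Whv; rewrite nbhs_simpl /=.
  have := @nbhs_principalE (discrete_topology (C 0)).
  by move=> /(congr1 (fun N => N v)) ->; apply/principal_filterP.
- by move=> u v /(chi_disj ti0 ti0)/eqP; rewrite eq_Tagged => /eqP.
- move=> v; rewrite /open_cell image_comp; apply: eq_imagel => t _ /=.
  by rewrite (t0E t).
- move=> v; rewrite /closed_simplex image_comp; apply: eq_imagel => t _ /=.
  by rewrite (t0E t).
- by move=> u v /eqP; rewrite eq_Tagged => /eqP.
- move=> [d c]; split=> [|[v <-]//]; rewrite leqn0 => /eqP/= dE.
  by move: c; rewrite dE => c; exists c.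
- by move=> v; exists v, t0.
Qed.

Lemma skeleton_exists D : exists K h e, built_up_to D K /\ @skeleton D K h e.
Proof.
elim: D => [|i [K [h [e [bK sk]]]]].
  have [h [e sk]] := points_skeleton; exists (points R (C 0)), h, e.
  by split=> //; exact: built_points.
have [phi [phi_gl phi_chi]] := gluing_exists sk.
exists (attach phi), (@attach_map _ _ h phi), (@attach_label _ _ e phi); split.
  exact: built_attach.
exact: attach_skeleton.
Qed.

(** Once every dimension up to [D] is attached, [h] is onto; a continuous bijection from a compact
    space to a Hausdorff space is a homeomorphism. *)
Theorem cellulation_exists (D : nat) (x0 : X) :
  (forall x, exists d (c : C d) t,
    [/\ (d <= D)%N, simplex_interior R d t & chi c t = x]) ->
  exists (K : cell_space R) (e : cell K -> {d & C d}),
    [/\ generalised_simplicial_complex K, homeomorphic (underlying_space K) X,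
        (forall c, tag (e c) = cdim c) /\ injective e,
        (forall x, (tag x <= D)%N -> exists c, e c = x) &
        forall c c', closed_simplex c `<=` closed_simplex c' <->
          range (chi (tagged (e c))) `<=` range (chi (tagged (e c')))].
Proof.
move=> cover; have [K [h [e [bK sk]]]] := skeleton_exists D.
have hsurj x : exists s, h s = x.
  have [d [c [t [dD ti <-]]]] := cover x.
  have [c' c'E] : exists c', e c' = existT _ d c by apply/(skel_cells sk).
  have := skel_open sk c'; rewrite c'E /= => /seteqP[_ /(_ (chi c t))].
  by case=> [|s _ sE]; [exists t|exists s].
exists K, e; split.
- by exists D.
- have [s0 _] := hsurj x0.
  have [g [hK cg]] := compact_injective_inverse s0 (skel_compact sk) hX
    (skel_cont sk) (@skel_inj _ _ _ _ sk).
  exists h, g; split=> //; first exact: (skel_cont sk).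
    rewrite (_ : range h = setT) in cg.
      by apply/continuous_subspace_setT.
    by apply/seteqP; split=> // x _; have [s <-] := hsurj x; exists s.
  by move=> x; have [s <-] := hsurj x; rewrite hK.
- by split; [exact: (skel_dim sk)|exact: (@skel_cells_inj _ _ _ _ sk)].
- by move=> x /(skel_cells sk).
move=> c c'; rewrite -!(skel_closed sk); split=> [cc'|cc' x cx].
  exact: image_subset.
have [|y c'y /(skel_inj sk) <-//] := cc' (h x).
by exists x.
Qed.

End skeleta.

(** * Projective space *)

Section projective.
Variables (R : realType) (m : nat).
Implicit Types x y : 'rV[R]_m.+1.

Definition sqnorm x : R := \sum_i x 0 i ^+ 2.

Lemma sqnorm_ge0 x : 0 <= sqnorm x.
Proof. by apply: sumr_ge0 => i _; exact: sqr_ge0. Qed.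

Lemma sqnorm_gt0 x : (0 < sqnorm x) = (x != 0).
Proof.
rewrite lt0r sqnorm_ge0 andbT; congr negb; apply/eqP/eqP => [x0|->].
  apply/rowP => i; rewrite mxE; apply/eqP; rewrite -sqrf_eq0.
  move/eqP: x0; rewrite psumr_eq0 => [/allP/(_ i)|j _]; last exact: sqr_ge0.
  by rewrite mem_index_enum => /(_ isT).
by rewrite /sqnorm big1 // => i _; rewrite mxE expr0n.
Qed.

Lemma sqnormZ a x : sqnorm (a *: x) = a ^+ 2 * sqnorm x.
Proof. by rewrite /sqnorm mulr_sumr; apply: eq_bigr => i _; rewrite mxE exprMn. Qed.

Definition direction x := (Num.sqrt (sqnorm x))^-1 *: x.

Lemma direction_sphere x : x != 0 -> sphere R m (direction x).
Proof.
rewrite -sqnorm_gt0 => x0.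
by rewrite /sphere/= -/(sqnorm _) sqnormZ exprVn sqr_sqrtr ?ltW// mulVf// gt_eqF.
Qed.

Lemma sphere_neq0 x : sphere R m x -> x != 0.
Proof. by rewrite -sqnorm_gt0 /sphere/= -/(sqnorm x) => ->; exact: ltr01. Qed.

Lemma direction_id x : sphere R m x -> direction x = x.
Proof.
by rewrite /sphere/= -/(sqnorm x) /direction => ->; rewrite sqrtr1 invr1 scale1r.
Qed.

Lemma sphere_nonempty : exists x, sphere R m x.
Proof.
exists (direction (const_mx 1)); apply: direction_sphere; apply/eqP.
by move=> /rowP/(_ 0)/eqP; rewrite !mxE oner_eq0.
Qed.

Definition sphere_base : sphere R m := SigSub (mem_set (projT2 (cid sphere_nonempty))).

(** At the origin the value is the arbitrary point [sphere_base]; the lemmas about it assume a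
    nonzero vector. *)
Definition sphere_direction x : sphere R m := insubd sphere_base (direction x).

Lemma val_sphere_direction x : x != 0 -> val (sphere_direction x) = direction x.
Proof. by move=> /direction_sphere x0; rewrite val_insubd mem_set. Qed.

Definition line x : projective_space R m :=
  \pi_(projective_space R m) (sphere_direction x).

Lemma line_eqP x y : x != 0 -> y != 0 ->
  line x = line y <-> exists2 a, a != 0 & y = a *: x.
Proof.
move=> x0 y0.
have nx : Num.sqrt (sqnorm x) != 0 by rewrite gt_eqF// sqrtr_gt0 sqnorm_gt0.
have ny : Num.sqrt (sqnorm y) != 0 by rewrite gt_eqF// sqrtr_gt0 sqnorm_gt0.
have -> : line x = line y <->
    direction x = direction y \/ direction x = - direction y.
  rewrite -(val_sphere_direction x0) -(val_sphere_direction y0); split.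
    by move=> /eqmodP/orP[]/eqP; [left|right].
  by move=> xy; apply/eqmodP/orP; case: xy => /eqP; [left|right].
split.
  by case=> /(congr1 (fun z => Num.sqrt (sqnorm y) *: z));
    rewrite ?scalerN /direction scalerA (scalerA _ _ y) mulfV// scale1r => yE;
    [exists (Num.sqrt (sqnorm y) / Num.sqrt (sqnorm x))
    |exists (- (Num.sqrt (sqnorm y) / Num.sqrt (sqnorm x)))];
    rewrite ?scaleNr ?yE ?opprK// ?oppr_eq0 mulf_neq0// invr_eq0.
move=> [a a0 ->]; rewrite /direction sqnormZ sqrtrM ?sqr_ge0// sqrtr_sqr scalerA.
rewrite invfM mulrAC; case: (ltgtP 0 a) => a'; last by rewrite -a' eqxx in a0.
  by left; rewrite gtr0_norm// mulVf// mul1r.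
by right; rewrite ltr0_norm// invrN mulNr mulVf// mulNr mul1r scaleNr opprK.
Qed.

Lemma line_surj p : exists2 x, x != 0 & line x = p.
Proof.
rewrite -[p]reprK; case: (repr p) => x Sx; have xS := set_mem Sx.
exists x; first exact: sphere_neq0.
congr (\pi _); apply: val_inj.
by rewrite val_sphere_direction ?sphere_neq0// direction_id.
Qed.

Lemma line_continuous (T : topologicalType) (f : T -> 'rV[R]_m.+1) :
  (forall t, f t != 0) -> continuous f -> continuous (line \o f : T -> projective_space R
    m).
Proof.
move=> f0 cf.
have cd : continuous (direction \o f).
  move=> t; apply: cvgZ; last exact: cf.
  apply: cvgV; first by rewrite gt_eqF// sqrtr_gt0 sqnorm_gt0.
  apply: continuous_comp; last exact: sqrt_continuous.
  apply: (sum_continuous (F := fun i t => (f t) 0 i ^+ 2)) => i s.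
  apply: cvgM;
    by apply: (continuous_comp (f := f) (g := fun M : 'rV[R]_m.+1 => M 0 i));
      [exact: cf|exact: coord_continuous].
have ci : continuous (fun t => sphere_direction (f t)).
  apply: (@continuous_comp_initial _ _ _ set_val).
  rewrite (_ : _ \o _ = direction \o f)//; apply/funext => t /=.
  exact: val_sphere_direction.
move=> t; apply: (continuous_comp (f := fun t => sphere_direction (f t))
  (g := \pi_(projective_space R m))); first exact: ci.
exact: (@pi_continuous _ (projective_space R m)).
Qed.

(** The products of two coordinates do not see the sign of a unit vector, so they are continuous on
    the quotient. They separate its points: at a nonzero coordinate the square fixes that coordinate
    up to sign, and the mixed products then fix all the others. *)
Lemma projective_hausdorff : hausdorff_space (projective_space R m).
Proof.
apply: (@separated_hausdorff R) => p q pq; apply: contrapT => nsep; apply: pq.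
pose g i j (s : sphere R m) := (val s : 'rV[R]_m.+1) 0 i * (val s : 'rV[R]_m.+1) 0 j.
have cc i : continuous (fun s : sphere R m => (val s : 'rV[R]_m.+1) 0 i).
  move=> s; apply: (continuous_comp (f := fun s : sphere R m => val s)
    (g := fun M : 'rV[R]_m.+1 => M 0 i)); last exact: coord_continuous.
  exact: initial_continuous.
have cg i j : continuous (g i j \o repr : projective_space R m -> R).
  apply: (@repr_comp_continuous _ (projective_space R m)).
    by move=> s; exact: (cvgM (cc i s) (cc j s)).
  move=> a b /eqP/eqmodP/orP[]/eqP ab; rewrite /g ab ?eqxx//.
  by rewrite !mxE mulrNN eqxx.
have gE i j : g i j (repr p) = g i j (repr q).
  by apply: contrapT => ne; apply: nsep; exists (g i j \o repr).
rewrite -[p]reprK -[q]reprK; apply/eqmodP => /=; apply/orP.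
have xS := set_valP (repr p).
move: gE xS; rewrite /g; set x : 'rV_m.+1 := val (repr p); set y : 'rV_m.+1 := val (repr q).
move=> gE /sphere_neq0 x0.
have [i xi] : exists i, x 0 i != 0.
  apply: contrapT => n; move/eqP: x0; apply; apply/rowP => i; rewrite mxE.
  by apply: contrapT => /eqP xi; apply: n; exists i.
have : x 0 i ^+ 2 = y 0 i ^+ 2 by rewrite !expr2.
move=> /eqP; rewrite eqf_sqr => /orP[]/eqP xy; [left|right]; apply/eqP/rowP => j;
  apply: (mulfI xi); rewrite gE xy ?mxE ?mulrNN//.
Qed.

End projective.

Lemma scale_continuous (R : realType) (T : topologicalType) (V : normedModType R)
    (f : T -> R) (v : V) : continuous f -> continuous (fun t => f t *: v).
Proof. by move=> cf t; apply: cvgZr_tmp; exact: cf. Qed.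

(** * Quotients of symmetric fans *)

Section symmetric_fan.
Variables (R : realType) (m : nat) (V : finType) (anti : V -> V).
Variables (pos : V -> 'rV[R]_m.+1) (splx : pred {set V}).

(** The pair [pos], [splx] is a complete simplicial fan that is symmetric about the origin: [a]
    lists the coordinates of a vector in the cone over the simplex [supp a]. *)
Definition comb (a : V -> R) : 'rV[R]_m.+1 := \sum_v a v *: pos v.
Definition supp (a : V -> R) : {set V} := [set v | 0 < a v]%SET.
Definition opp_set (s : {set V}) : {set V} := (anti @: s)%SET.

Hypothesis antiK : involutive anti.
Hypothesis pos_anti : forall v, pos (anti v) = - pos v.
Hypothesis splx0 : ~~ splx finset.set0.
Hypothesis splx_sub : forall s t : {set V},
  splx s -> t \subset s -> t != finset.set0 -> splx t.
Hypothesis splx_opp : forall s, splx s -> splx (opp_set s).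
Hypothesis splx_anti : forall s v, splx s -> v \in s -> anti v \notin s.
Hypothesis fan_cover : forall x, x != 0 ->
  exists a : V -> R, [/\ forall v, 0 <= a v, splx (supp a) & x = comb a].
Hypothesis fan_unique : forall a b : V -> R,
  (forall v, 0 <= a v) -> (forall v, 0 <= b v) ->
  splx (supp a) -> splx (supp b) -> comb a = comb b -> forall v, a v = b v.

Lemma mem_opp_set s v : (v \in opp_set s) = (anti v \in s).
Proof. by rewrite -{1}[v]antiK mem_imset //; exact: can_inj antiK. Qed.

Lemma opp_setK : involutive opp_set.
Proof. by move=> s; apply/setP => v; rewrite !mem_opp_set antiK. Qed.

Lemma card_opp_set s : #|opp_set s| = #|s|.
Proof. by apply: card_imset; exact: can_inj antiK. Qed.

Lemma combZ s a : comb (fun v => s * a v) = s *: comb a.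
Proof. by rewrite /comb scaler_sumr; apply: eq_bigr => v _; rewrite scalerA. Qed.

Lemma comb_anti a : comb (fun v => a (anti v)) = - comb a.
Proof.
rewrite /comb (reindex_inj (can_inj antiK)) -sumrN; apply: eq_bigr => v _.
by rewrite antiK pos_anti scalerN.
Qed.

Lemma supp_anti a : supp (a \o anti) = opp_set (supp a).
Proof. by apply/setP => v; rewrite mem_opp_set !inE. Qed.

Lemma suppZ s a : 0 < s -> supp (fun v => s * a v) = supp a.
Proof. by move=> s0; apply/setP => v; rewrite !inE pmulr_rgt0. Qed.

(** If the combination vanished, [a] and its double would represent the same point; uniqueness then
    makes [a] zero and its support empty. *)
Lemma comb_neq0 a : (forall v, 0 <= a v) -> splx (supp a) -> comb a != 0.
Proof.
move=> a0 sa; apply/eqP => c0; case/negP: splx0.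
suff <- : supp a = finset.set0 by [].
have aa v : a v = 2 * a v.
  apply: (fan_unique (b := fun v => 2 * a v)) => // [w||].
  - by rewrite mulr_ge0.
  - by rewrite suppZ.
  - by rewrite combZ c0 scaler0.
apply/setP => v; rewrite !inE; apply/negbTE; rewrite -leNgt.
by have := aa v; rewrite mulrDl !mul1r => /eqP;
  rewrite -subr_eq0 opprD addrA subrr sub0r oppr_eq0 => /eqP->.
Qed.

(** Two representatives of a line differ by a scalar. A negative scalar is absorbed by [anti], and
    uniqueness of coordinates does the rest. *)
Lemma line_comb a b : (forall v, 0 <= a v) -> (forall v, 0 <= b v) ->
  splx (supp a) -> splx (supp b) -> line (comb a) = line (comb b) ->
  exists2 s, 0 < s & (forall v, b v = s * a v) \/ (forall v, b v = s * a (anti v)).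
Proof.
move=> a0 b0 sa sb /line_eqP; case; [exact: comb_neq0..|] => l l0 ab.
case: (ltgtP 0 l) l0 => // [lp _|ln _].
  exists l => //; left; apply: fan_unique => // [v||].
  - by rewrite mulr_ge0 // ltW.
  - by rewrite suppZ.
  - by rewrite combZ.
exists (- l); first by rewrite oppr_gt0.
right; apply: fan_unique => // [v||].
- by rewrite mulr_ge0 // oppr_ge0 ltW.
- by rewrite (suppZ (a \o anti)) ?oppr_gt0// supp_anti splx_opp.
- by rewrite combZ comb_anti scalerN scaleNr opprK.
Qed.

Lemma line_comb_anti a : (forall v, 0 <= a v) -> splx (supp a) ->
  line (comb (a \o anti)) = line (comb a).
Proof.
move=> a0 sa; apply/line_eqP; rewrite ?comb_anti ?oppr_eq0 ?comb_neq0//.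
by exists (-1); rewrite ?oppr_eq0 ?oner_eq0// scaleN1r opprK.
Qed.

Lemma line_combZ s a : 0 < s -> (forall v, 0 <= a v) -> splx (supp a) ->
  line (comb (fun v => s * a v)) = line (comb a).
Proof.
move=> s0 a0 sa; apply/esym/line_eqP; rewrite ?combZ ?scaler_eq0 ?negb_or ?comb_neq0
  ?gt_eqF//.
by exists s; rewrite ?gt_eqF.
Qed.

(* Selects one simplex from each antipodal pair, to index the cells of the quotient. *)
Definition canonical_set (s : {set V}) := (enum_rank s <= enum_rank (opp_set s))%N.

Lemma canonical_set_total s : canonical_set s || canonical_set (opp_set s).
Proof. by rewrite /canonical_set opp_setK leq_total. Qed.

Lemma canonical_set_opp s : canonical_set s -> canonical_set (opp_set s) -> opp_set s = s.
Proof.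
rewrite /canonical_set opp_setK => s1 s2; apply/enum_rank_inj/val_inj/eqP.
by rewrite eqn_leq s1 s2.
Qed.

Definition face_cell (d : nat) : finType :=
  {s : {set V} | [&& splx s, #|s| == d.+1 & canonical_set s]}.

Section face.
Variables (d : nat) (s : {set V}).
Hypotheses (ss : splx s) (cs : #|s| = d.+1).

Definition corner_index (v : V) : 'I_d.+1 := inord (index v (enum s)).

Lemma corner_index_inj : {in s &, injective corner_index}.
Proof.
have ix v : v \in s -> (index v (enum s) < d.+1)%N.
  by move=> vs; rewrite -cs cardE index_mem mem_enum.
move=> v w vs ws /(congr1 val); rewrite /= !inordK ?ix// => vw.
by rewrite -[v](nth_index v (s := enum s)) ?mem_enum// vw nth_index// mem_enum.
Qed.

Lemma corner_index_surj j : exists2 v, v \in s & corner_index v = j.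
Proof.
have [v0 _] : exists v0, v0 \in s by apply/finset.set0Pn; rewrite -card_gt0 cs.
have js : (j < size (enum s))%N by rewrite -cardE cs.
exists (nth v0 (enum s) j); first by rewrite -mem_enum mem_nth.
by rewrite /corner_index index_uniq ?enum_uniq// inord_val.
Qed.

Definition weight (t : simplex R d) (v : V) : R :=
  if v \in s then (val t : 'rV[R]_d.+1) 0 (corner_index v) else 0.

Lemma weight_ge0 t v : 0 <= weight t v.
Proof. by rewrite /weight; case: ifP => // _; have [] := set_valP t. Qed.

Lemma weight_supp_sub t : supp (weight t) \subset s.
Proof. by apply/fintype.subsetP => v; rewrite inE /weight; case: ifP => //;
  rewrite ltxx. Qed.

Lemma weight_splx t : splx (supp (weight t)).
Proof.
apply: splx_sub ss (weight_supp_sub t) _; apply/finset.set0Pn.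
have [j tj] : exists j, 0 < (val t : 'rV[R]_d.+1) 0 j.
  apply: contrapT => n; have [t0 t1] := set_valP t; move/eqP: t1.
  rewrite big1 ?(eq_sym 0) ?oner_eq0// => j _; apply/eqP; rewrite eq_le t0 andbT leNgt.
  by apply/negP => tj; apply: n; exists j.
have [v vs vj] := corner_index_surj j.
by exists v; rewrite inE /weight vs vj.
Qed.

(** Coordinates supported in [s] become barycentric after division by their sum, which is
    positive. *)
Lemma weight_exists a : (forall v, 0 <= a v) -> supp a \subset s ->
  supp a != finset.set0 ->
  exists t, exists2 l, 0 < l & forall v, weight t v = l * a v.
Proof.
move=> a0 as_ an.
have /boolp.choice[f fK] : forall j : 'I_d.+1, exists v, v \in s /\ corner_index v = j.
  by move=> j; have [v] := corner_index_surj j; exists v.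
pose S := \sum_j a (f j).
have fv v : v \in s -> f (corner_index v) = v.
  by move=> vs; apply: corner_index_inj => //; have [] := fK (corner_index v).
have S0 : 0 < S.
  have /finset.set0Pn[v va] := an; have vs := fintype.subsetP as_ _ va.
  rewrite /S (bigD1 (corner_index v))//= fv// ltr_pwDl ?sumr_ge0//.
  by rewrite inE in va.
have tS : simplex R d (\row_j (S^-1 * a (f j))).
  split=> [j|]; first by rewrite mxE mulr_ge0 // invr_ge0 ltW.
  rewrite (eq_bigr (fun j => S^-1 * a (f j))) => [|j _]; last by rewrite mxE.
  by rewrite -mulr_sumr mulVf// gt_eqF.
exists (SigSub (mem_set tS)), S^-1 => [|v]; first by rewrite invr_gt0.
rewrite /weight; case: ifPn => vs; first by rewrite /= mxE fv.
suff -> : a v = 0 by rewrite mulr0.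
apply/eqP; rewrite eq_le a0 andbT leNgt; apply/negP => va; case/negP: vs.
by apply: (fintype.subsetP as_); rewrite inE.
Qed.

Definition face_map (t : simplex R d) : projective_space R m := line (comb (weight t)).

Lemma face_map_continuous : continuous face_map.
Proof.
apply: (line_continuous (f := fun t => comb (weight t))) => [t|].
  by apply: comb_neq0; [exact: weight_ge0|exact: weight_splx].
apply: sum_continuous => v; apply: scale_continuous.
rewrite /weight; case: (v \in s); first exact: simplex_coord_continuous.
by apply: cst_continuous.
Qed.

Lemma face_map_inj : injective face_map.
Proof.
move=> t u /(line_comb (weight_ge0 t) (weight_ge0 u) (weight_splx t) (weight_splx u))[l l0].
(* The antipodal alternative would put a vertex and its antipode into [s]; in the other one both
   coordinate sums are 1, so the factor is 1. *)
case=> [tu|tu]; last first.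
  have /finset.set0Pn[v] : supp (weight u) != finset.set0.
    by apply/eqP => u0; have := weight_splx u; rewrite u0 (negbTE splx0).
  move=> vu; have vs := fintype.subsetP (weight_supp_sub u) _ vu.
  move: vu; rewrite inE tu pmulr_rgt0// => av; have /negP[] := splx_anti ss vs.
  by apply: (fintype.subsetP (weight_supp_sub t)); rewrite inE.
have tuj j : (val u : 'rV[R]_d.+1) 0 j = l * (val t : 'rV[R]_d.+1) 0 j.
  have [v vs <-] := corner_index_surj j.
  by have := tu v; rewrite /weight vs.
have l1 : l = 1.
  have [_ <-] := set_valP u; under eq_bigr do rewrite tuj.
  by have [_] := set_valP t; rewrite -mulr_sumr => ->; rewrite mulr1.
by apply/val_inj/rowP => j; rewrite tuj l1 mul1r.
Qed.

Definition open_cone (t : {set V}) : set (projective_space R m) :=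
  [set p | exists a : V -> R, [/\ forall v, 0 <= a v, supp a = t & p = line (comb a)]].

Lemma face_map_open_face (F : {set 'I_d.+1}) : F != finset.set0 ->
  face_map @` open_face R d F = open_cone [set v in s | corner_index v \in F]%SET.
Proof.
move=> F0; apply/seteqP; split=> [_ [t tF <-]|_ [a [a0 sa ->]]].
  exists (weight t); split=> //; first exact: weight_ge0.
  apply/setP => v; rewrite !inE -tF /weight; case: (v \in s) => //=; exact: ltxx.
have as_ : supp a \subset s by rewrite sa; apply/fintype.subsetP => v; rewrite inE =>
  /andP[].
have an : supp a != finset.set0.
  have /finset.set0Pn[j jF] := F0; have [v vs vj] := corner_index_surj j.
  by rewrite sa; apply/finset.set0Pn; exists v; rewrite inE vs vj.
have [t [l l0 tl]] := weight_exists a0 as_ an.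
exists t; last first.
  rewrite /face_map (_ : weight t = fun v => l * a v); last exact/funext.
  by apply: line_combZ => //; exact: splx_sub as_ an.
move=> j; have [v vs <-] := corner_index_surj j.
have := tl v; rewrite /weight vs => ->; rewrite pmulr_rgt0//.
by have /setP/(_ v) := sa; rewrite !inE vs.
Qed.

Lemma face_map_interior : face_map @` simplex_interior R d = open_cone s.
Proof.
have -> : simplex_interior R d = open_face R d [set: 'I_d.+1]%SET.
  apply/seteqP; split=> t ti j; first by rewrite inE; exact: ti.
  by rewrite ti inE.
rewrite face_map_open_face; first by congr open_cone; apply/setP => v; rewrite !inE andbT.
by apply/finset.set0Pn; exists ord0; rewrite inE.
Qed.

Lemma card_corner_index (F : {set 'I_d.+1}) :
  #|[set v in s | corner_index v \in F]%SET| = #|F|.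
Proof.
rewrite -[LHS](card_in_imset (f := corner_index)); last first.
  by move=> v w; rewrite !inE => /andP[vs _] /andP[ws _]; exact: corner_index_inj.
congr #|pred_of_set _|; apply/setP => j; apply/imsetP/idP => [[v]|jF].
  by rewrite inE => /andP[_ vF] ->.
by have [v vs vj] := corner_index_surj j; exists v; rewrite // inE vs vj.
Qed.

End face.

Lemma open_cone_opp s : splx s -> open_cone (opp_set s) = open_cone s.
Proof.
have oc s' : splx s' -> open_cone s' `<=` open_cone (opp_set s').
  move=> ss _ [a [a0 sa ->]]; exists (a \o anti); split=> [v||].
  - exact: a0.
  - by rewrite supp_anti sa.
  - by rewrite line_comb_anti // sa.
move=> ss; apply/seteqP; split; last exact: oc.
by rewrite -{2}[s]opp_setK; apply: oc; exact: splx_opp.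
Qed.

Lemma face_cellP d (c : face_cell d) :
  [/\ splx (val c), #|val c| = d.+1 & canonical_set (val c)].
Proof. by have /and3P[sc /eqP dc cc] := valP c. Qed.

Lemma face_cell_exists s : splx s -> exists d (c : face_cell d),
  #|s| = d.+1 /\ (val c = s \/ val c = opp_set s).
Proof.
move=> ss; have [d ds] : exists d, #|s| = d.+1.
  exists #|s|.-1; rewrite prednK // card_gt0; apply/eqP => s0.
  by move: ss; rewrite s0 (negbTE splx0).
exists d; have := canonical_set_total s; have [cs _|_ /= co] := boolP (canonical_set s).
  have cP : [&& splx s, #|s| == d.+1 & canonical_set s] by rewrite ss ds eqxx.
  by exists (Sub s cP); split=> //; left; rewrite SubK.
have cP : [&& splx (opp_set s), #|opp_set s| == d.+1 & canonical_set (opp_set s)].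
  by rewrite splx_opp// card_opp_set ds eqxx.
by exists (Sub (opp_set s) cP); split=> //; right; rewrite SubK.
Qed.

Lemma open_cone_cell s : splx s -> exists d (c : face_cell d), #|s| = d.+1 /\
  open_cone s = face_map (val c) @` simplex_interior R d.
Proof.
move=> ss; have [d [c [ds cE]]] := face_cell_exists ss.
exists d, c; split=> //; have [sc dc _] := face_cellP c.
rewrite face_map_interior//; case: cE => -> //.
by rewrite open_cone_opp.
Qed.

Lemma face_map_eq d d' (c : face_cell d) (c' : face_cell d')
    (t : simplex R d) (t' : simplex R d') :
  face_map (val c) t = face_map (val c') t' ->
  supp (weight (val c') t') = supp (weight (val c) t) \/
  supp (weight (val c') t') = opp_set (supp (weight (val c) t)).
Proof.
have [sc dc _] := face_cellP c; have [sc' dc' _] := face_cellP c'.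
move=> /(line_comb (weight_ge0 _ t) (weight_ge0 _ t') (weight_splx sc dc t)
  (weight_splx sc' dc' t'))[l l0 [tt'|tt']]; [left|right].
  by rewrite -(suppZ (weight (val c) t) l0); congr supp; exact/funext.
by rewrite -supp_anti -(suppZ (weight (val c) t \o anti) l0); congr supp; exact/funext.
Qed.

Lemma weight_interior d (s : {set V}) (t : simplex R d) :
  simplex_interior R d t -> supp (weight s t) = s.
Proof.
move=> ti; apply/setP => v; rewrite inE /weight; case: (v \in s); last by rewrite ltxx.
exact: ti.
Qed.

Lemma face_cell_inj d d' (c : face_cell d) (c' : face_cell d') :
  val c = val c' \/ val c = opp_set (val c') -> Tagged face_cell c = Tagged face_cell c'.
Proof.
have [_ dc cc] := face_cellP c; have [_ dc' cc'] := face_cellP c'.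
move=> cE; have {}cE : val c = val c'.
  by case: cE => // cE; move: cc; rewrite cE => /(canonical_set_opp cc').
have dE : d = d' by apply/succn_inj; rewrite -dc -dc' cE.
case: _ / dE c' cc' dc' cE => c' _ _ cE.
by congr Tagged; exact: val_inj.
Qed.

(** An interior point of the first cell has full support, so the point of the second cell on the
    same line has that support or its opposite. Conversely, coordinates may be moved to the antipode
    without changing the line. *)
Lemma range_face_map_sub d d' (c : face_cell d) (c' : face_cell d') :
  range (face_map (val c) : simplex R d -> _) `<=`
    range (face_map (val c') : simplex R d' -> _) <->
  val c \subset val c' \/ opp_set (val c) \subset val c'.
Proof.
have [sc dc _] := face_cellP c; have [sc' dc' _] := face_cellP c'.
split=> [sub|sub _ [t _ <-]].
  have [t ti] := simplex_interior_nonempty R d.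
  have [|t' _ tt'] := sub (face_map (val c) t); first by exists t.
  have := weight_supp_sub (val c') t'.
  case: (face_map_eq (esym tt')) => ->; rewrite weight_interior//; by [left|right].
have lc a : (forall v, 0 <= a v) -> supp a \subset val c' -> supp a != finset.set0 ->
    range (face_map (val c') : simplex R d' -> _) (line (comb a)).
  move=> a0 as_ an; have [u [l l0 ul]] := weight_exists dc' a0 as_ an.
  exists u => //; rewrite /face_map (_ : weight (val c') u = fun v => l * a v);
    last exact/funext.
  by apply: line_combZ => //; exact: splx_sub as_ an.
have wn : supp (weight (val c) t) != finset.set0.
  by apply/eqP => w0; have := weight_splx sc dc t; rewrite w0 (negbTE splx0).
case: sub => sub; first by apply: lc wn; [exact: weight_ge0|exact: fintype.subset_trans
  (weight_supp_sub _ _) sub].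
rewrite /face_map -line_comb_anti; [|exact: weight_ge0|exact: weight_splx].
apply: lc => [v||]; first exact: weight_ge0.
  apply: fintype.subset_trans sub; rewrite supp_anti; apply/fintype.subsetP => v.
  by rewrite !mem_opp_set; apply: (fintype.subsetP (weight_supp_sub _ _)).
by rewrite supp_anti -card_gt0 card_opp_set card_gt0.
Qed.

(** The open cones, one for each antipodal pair of simplices, partition the space of lines; they are
    the open cells fed to [cellulation_exists]. A simplex has at most #|V| corners, which bounds the
    dimension. *)
Theorem symmetric_fan_complex : exists (K : cell_space R) (S : cell K -> {set V}),
  [/\ generalised_simplicial_complex K,
      homeomorphic (underlying_space K) (projective_space R m),
      (forall c, splx (S c) /\ #|S c| = (cdim c).+1) /\
      (forall c c', S c = S c' \/ S c = opp_set (S c') -> c = c'),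
      (forall s, splx s -> exists c, S c = s \/ S c = opp_set s) &
      forall c c', closed_simplex c `<=` closed_simplex c' <->
        S c \subset S c' \/ opp_set (S c) \subset S c'].
Proof.
pose chi d (c : face_cell d) (t : simplex R d) := face_map (val c) t.
have chi_cont d (c : face_cell d) : continuous (chi d c).
  by have [sc dc _] := face_cellP c; exact: face_map_continuous.
have chi_inj d (c : face_cell d) : injective (chi d c).
  by have [sc dc _] := face_cellP c; exact: face_map_inj.
have chi_face d (c : face_cell d) (F : {set 'I_d.+1}) : F != finset.set0 ->
    exists d' (c' : face_cell d'), d'.+1 = #|F| /\
      chi d c @` open_face R d F = chi d' c' @` simplex_interior R d'.
  have [sc dc _] := face_cellP c => F0; rewrite /chi face_map_open_face//.
  have [|d' [c' [dF cF]]] :=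
      @open_cone_cell [set v in val c | corner_index d (val c) v \in F]%SET.
    apply: splx_sub sc _ _; first by apply/fintype.subsetP => v; rewrite inE => /andP[].
    by rewrite -card_gt0 card_corner_index// card_gt0.
  by exists d', c'; split=> //; rewrite -dF card_corner_index.
have chi_disj d d' (c : face_cell d) (c' : face_cell d') t t' :
    simplex_interior R d t -> simplex_interior R d' t' -> chi d c t = chi d' c' t' ->
    Tagged face_cell c = Tagged face_cell c'.
  move=> ti ti' /face_map_eq; rewrite !weight_interior// => cE; apply: face_cell_inj.
  by case: cE => ->; [left|right; rewrite opp_setK].
have cover p : exists d (c : face_cell d) t,
    [/\ (d <= #|V|)%N, simplex_interior R d t & chi d c t = p].
  have [x x0 <-] := line_surj p; have [a [a0 sa ->]] := fan_cover x0.
  have [d [c [ds cE]]] := open_cone_cell sa.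
  have : open_cone (supp a) (line (comb a)) by exists a.
  rewrite cE => -[t ti tE]; exists d, c, t; split=> //.
  by apply: ltnW; rewrite -ds max_card.
have [K [e [cK hK [de ei] es cl]]] := cellulation_exists (@projective_hausdorff R m)
  chi_cont chi_inj chi_face chi_disj (line (val (sphere_base R m))) cover.
exists K, (fun c => val (tagged (e c))).
have eP c := face_cellP (tagged (e c)).
split=> //.
- split=> [c|c c' cE]; first by have [? ? _] := eP c; rewrite -de.
  by apply: ei; have := face_cell_inj cE; case: (e c) => ? ?; case: (e c').
- move=> s ss; have [d [c [ds cE]]] := face_cell_exists ss.
  have [|c' c'E] := es (Tagged face_cell c); last by exists c'; rewrite c'E.
  by apply: ltnW; rewrite /= -ds max_card.
by move=> c c'; rewrite cl; exact: range_face_map_sub.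
Qed.

End symmetric_fan.

(** * The boundary of a box *)

Section grid.
Variables (R : realType) (m : nat) (M : 'I_m.+1 -> nat).

Definition grid : finType := {dffun forall i : 'I_m.+1, 'I_(M i).+1}.
Implicit Types (u v w : grid) (s : {set grid}).

Definition grid_rev v : grid := [ffun i => rev_ord (v i)].

(** Doubling the coordinates centres the box without fractions, so that [grid_rev] becomes
    negation. *)
Definition grid_pos v : 'rV[R]_m.+1 := \row_i ((v i)%:R *+ 2 - (M i)%:R).

Definition grid_step u v := [forall i, (u i <= v i <= (u i).+1)%N].

(** The pairwise condition makes [s] a chain in the coordinatewise order; applied to its least and
    greatest elements, it puts the whole chain into one unit cube. *)
Definition grid_chain s := [forall u in s, [forall v in s, grid_step u v || grid_step v u]].

Definition grid_facet s := [exists i,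
  [forall v in s, v i == 0 :> nat] || [forall v in s, v i == M i :> nat]].

Definition grid_simplex s := [&& s != finset.set0, grid_chain s & grid_facet s].

Lemma grid_revE v i : grid_rev v i = (M i - v i)%N :> nat.
Proof. by rewrite ffunE /= subSS. Qed.

Lemma grid_revK : involutive grid_rev.
Proof. by move=> v; apply/ffunP => i; rewrite !ffunE rev_ordK. Qed.

Lemma grid_leM v i : (v i <= M i)%N.
Proof. by rewrite -ltnS. Qed.

Lemma grid_pos_rev v : grid_pos (grid_rev v) = - grid_pos v.
Proof.
by apply/rowP => i; rewrite !mxE grid_revE natrB ?grid_leM// mulrnBl; ring.
Qed.

Lemma grid_stepP u v : reflect (forall i, (u i <= v i <= (u i).+1)%N) (grid_step u v).
Proof. exact: forallP. Qed.

Lemma grid_step_rev u v : grid_step u v -> grid_step (grid_rev v) (grid_rev u).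
Proof.
move=> /grid_stepP uv; apply/grid_stepP => i; rewrite !grid_revE.
by have := uv i; have := grid_leM u i; have := grid_leM v i; lia.
Qed.

Lemma grid_chainP s : reflect
  {in s &, forall u v, grid_step u v || grid_step v u} (grid_chain s).
Proof.
apply: (iffP forall_inP) => [h u v us vs|h u us].
  by have /forall_inP := h u us; apply.
by apply/forall_inP => v vs; exact: h.
Qed.

Lemma grid_facetP s : reflect
  (exists i, (forall v, v \in s -> v i = 0%N :> nat) \/
             (forall v, v \in s -> v i = M i :> nat)) (grid_facet s).
Proof.
apply: (iffP existsP) => -[i h]; exists i.
  by case/orP: h => /forall_inP h; [left|right] => v /h/eqP.
by apply/orP; case: h => h; [left|right]; apply/forall_inP => v /h/eqP.
Qed.

Lemma grid_simplex0 : ~~ grid_simplex finset.set0.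
Proof. by rewrite /grid_simplex eqxx. Qed.

Lemma grid_simplex_sub s (t : {set grid}) : grid_simplex s -> t \subset s -> t !=
  finset.set0 ->
  grid_simplex t.
Proof.
move=> /and3P[_ /grid_chainP cs /grid_facetP[i fi]] /fintype.subsetP ts t0.
apply/and3P; split=> //; first by apply/grid_chainP => u v /ts us /ts vs; exact: cs.
by apply/grid_facetP; exists i; case: fi => fi; [left|right] => v /ts/fi.
Qed.

Lemma grid_simplex_opp s : grid_simplex s -> grid_simplex (opp_set grid_rev s).
Proof.
move=> /and3P[s0 /grid_chainP cs /grid_facetP[i fi]]; apply/and3P; split.
- by rewrite -card_gt0 (card_opp_set grid_revK) card_gt0.
- apply/grid_chainP => u v; rewrite !(mem_opp_set grid_revK) => us vs.
  rewrite -[u]grid_revK -[v]grid_revK.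
  by have /orP[] := cs _ _ us vs => /grid_step_rev ->; rewrite ?orbT.
- apply/grid_facetP; exists i; case: fi => fi; [right|left] => v;
    rewrite (mem_opp_set grid_revK) => /fi; rewrite grid_revE;
    have := grid_leM v i; lia.
Qed.

Lemma grid_simplex_rev s v : (forall i, 0 < M i)%N -> grid_simplex s -> v \in s ->
  grid_rev v \notin s.
Proof.
move=> M0 /and3P[_ _ /grid_facetP[i fi]] vs; apply/negP => rs.
have Mi := M0 i.
by case: fi => fi; have := fi _ vs; have := fi _ rs; rewrite grid_revE; lia.
Qed.

End grid.

(** * Coordinates in the order triangulation *)

Section clamp.
Variables (R : realType) (V : finType) (a : V -> R) (f : V -> nat).
Hypothesis a0 : forall v, 0 <= a v.
Hypothesis fspread : forall u v, 0 < a u -> 0 < a v -> (f u <= (f v).+1)%N.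

(* If f takes only the values c - 1 and c on the support of a, the mass of [c <= f] is the
   linear expression; otherwise all of the mass lies on one side and the clamp applies. *)
Lemma upper_mass_clamp c : \sum_(v | (c <= f v)%N) a v =
  Num.max 0 (Num.min (\sum_v a v) (\sum_v a v * (f v)%:R + \sum_v a v - (\sum_v a v) *
    c%:R)).
Proof.
set s := \sum_v a v.
have -> : \sum_v a v * (f v)%:R + s - s * c%:R = \sum_v a v * ((f v)%:R + 1 - c%:R).
  rewrite /s mulr_suml -big_split -sumrB; apply: eq_bigr => v _ /=; ring.
set y := \sum_v a v * (_ + _ - _).
have U0 : 0 <= \sum_(v | (c <= f v)%N) a v by apply: sumr_ge0.
have s0 : 0 <= s by apply: sumr_ge0.
have Us : \sum_(v | (c <= f v)%N) a v <= s.
  by rewrite /s [leRHS](bigID (fun v => c <= f v)%N)/= lerDl sumr_ge0.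
have av v : a v = 0 \/ 0 < a v by have := a0 v; rewrite le_eqVlt => /predU1P[];
  [left|right].
have [/existsP[v /andP[va cv]]|/existsPn n1] := boolP [exists v, (0 < a v) && (c < f v)%N].
  have all_ge u : 0 < a u -> (c <= f u)%N by move=> ua; have := fspread va ua; lia.
  have -> : \sum_(v | (c <= f v)%N) a v = s.
    rewrite /s [RHS](bigID (fun v => c <= f v)%N)/= [X in _ + X]big1 ?addr0// => u cu.
    by case: (av u) => // /all_ge; rewrite (negbTE cu).
  have sy : s <= y.
    apply: ler_sum => u _; case: (av u) => [->|ua]; first by rewrite mul0r.
    by rewrite ler_peMr//; have := all_ge u ua; rewrite -(ler_nat R); lra.
  by rewrite (min_idPl sy) (max_idPr s0).
have [/existsP[v /andP[va cv]]|/existsPn n2] := boolP [exists v,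
  (0 < a v) && ((f v).+1 < c)%N].
  have all_lt u : 0 < a u -> (f u < c)%N by move=> ua; have := fspread ua va; lia.
  have -> : \sum_(v | (c <= f v)%N) a v = 0.
    by apply: big1 => u cu; case: (av u) => // /all_lt; lia.
  have y0 : y <= 0.
    apply: sumr_le0 => u _; case: (av u) => [->|ua]; first by rewrite mul0r.
    rewrite pmulr_rle0//; have := all_lt u ua; rewrite -(ler_nat R) -natr1; lra.
  by apply/esym/max_idPl; rewrite ge_min y0 orbT.
have <- : \sum_(v | (c <= f v)%N) a v = y.
  rewrite big_mkcond; apply: eq_bigr => u _; case: (av u) => [->|ua].
    by rewrite mul0r if_same.
  have := n1 u; have := n2 u; rewrite ua /= -!leqNgt => h1 h2.
  have [cu|cu] := leqP.
    have -> : f u = c by lia.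
    by rewrite addrAC subrr add0r mulr1.
  have -> : c = (f u).+1 by lia.
  by rewrite -natr1 subrr mulr0.
by rewrite (min_idPr Us) (max_idPr U0).
Qed.

End clamp.

Section peel.
Variables (R : realFieldType) (I : finType).

(* Repeatedly subtract the least positive coordinate times the indicator of the support:
   the t S are the barycentric coordinates of f in the order triangulation of [0, s]^I. *)
Lemma order_coordinates (f : I -> R) (s : R) : 0 <= s -> (forall i, 0 <= f i <= s) ->
  exists t : {set I} -> R, [/\ forall S, 0 <= t S, \sum_S t S = s,
    forall i, \sum_(S : {set I} | i \in S) t S = f i &
    forall S T, 0 < t S -> 0 < t T -> (S \subset T) || (T \subset S)].
Proof.
have [n] := ubnP #|[set i | 0 < f i]%SET|; elim: n f s => // n IH f s.
rewrite ltnS => fn s0 f0s; have f0 i : 0 <= f i by have /andP[] := f0s i.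
have [/existsP[i0 fi0]|/existsPn fz] := boolP [exists i, 0 < f i]; last first.
  have fE i : f i = 0 by apply/eqP; rewrite eq_le f0 andbT leNgt fz.
  exists (fun S => if S == finset.set0 then s else 0); split=> [S||i|S T].
  - by case: ifP.
  - by rewrite -big_mkcond big_pred1_eq.
  - rewrite fE; apply: big1 => S iS; case: eqP => // S0; by rewrite S0 inE in iS.
  - by case: eqP => [->|]; rewrite ?ltxx// finset.sub0set.
pose i1 := [arg min_(i < i0 | 0 < f i) f i]%O.
have [fi1 i1min] : 0 < f i1 /\ forall i, 0 < f i -> f i1 <= f i.
  by rewrite /i1; case: arg_minP.
pose F := [set i | 0 < f i]%SET.
pose g i := if i \in F then f i - f i1 else f i.
have gE i : i \notin F -> g i = 0.
  move=> iF; rewrite /g (negbTE iF); apply/eqP; rewrite eq_le f0 andbT leNgt.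
  by rewrite inE in iF.
have g0 i : 0 <= g i.
  by have [|/gE->//] := boolP (i \in F); rewrite /g => iF; rewrite iF subr_ge0 i1min;
    rewrite inE in iF.
have gF : [set i | 0 < g i]%SET \subset F.
  by apply/fintype.subsetP => i; rewrite inE; apply: contraTT => /gE ->; rewrite ltxx.
have i1F : i1 \in F by rewrite inE.
have [||i|t [t0 ts tf tc]] := IH g (s - f i1).
- apply: leq_trans fn; apply: proper_card; apply/fintype.properP; split=> //.
  by exists i1 => //; rewrite inE /g i1F subrr ltxx.
- by have /andP[_] := f0s i1; rewrite subr_ge0.
- rewrite g0 /=; have [iF|/gE->] := boolP (i \in F); last first.
    by have /andP[_] := f0s i1; rewrite subr_ge0.
  by rewrite /g iF lerD2r; have /andP[] := f0s i.
(* As [g] vanishes off [F], every set that already carries weight lies in [F]; adding [F] on top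
   keeps the chain. *)
have tF S : 0 < t S -> S \subset F.
  move=> tS; apply/fintype.subsetP => i iS; apply/negPn/negP => /gE gi.
  have := tf i; rewrite gi (bigD1 S)//= => tS0.
  suff : 0 < t S + \sum_(T : {set I} | (i \in T) && (T != S)) t T by rewrite tS0 ltxx.
  by rewrite ltr_pwDl// sumr_ge0.
exists (fun S => t S + (if S == F then f i1 else 0)); split=> [S||i|S T].
- by rewrite addr_ge0//; case: ifP => // _; exact: ltW.
- by rewrite big_split/= ts -big_mkcond big_pred1_eq subrK.
- rewrite big_split/= tf; have [iF|iF] := boolP (i \in F).
    rewrite (bigD1 F)//= eqxx big1 => [|S /andP[_ /negbTE->]//].
    by rewrite addr0 /g iF subrK.
  rewrite big1 => [|S iS]; first by rewrite addr0 /g (negbTE iF).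
  by case: eqP => // SF; rewrite SF (negbTE iF) in iS.
- have [->|_] := eqVneq S F; have [->|_] := eqVneq T F; rewrite ?addr0 ?fintype.subxx//.
  + by move=> _ /tF ->; rewrite orbT.
  + by move=> /tF ->.
  + exact: tc.
Qed.

End peel.

(** * The cones over the box boundary form a complete fan *)

Section grid_fan.
Variables (R : realType) (m : nat) (M : 'I_m.+1 -> nat).
Hypothesis M0 : forall i, (0 < M i)%N.
Local Notation grid := (grid M).
Local Notation pos := (@grid_pos R m M).
Implicit Types (u v w : grid).

Lemma comb_posE (a : grid -> R) i :
  comb pos a 0 i = (\sum_v a v * (v i)%:R) *+ 2 - (\sum_v a v) * (M i)%:R.
Proof.
rewrite /comb summxE mulr_suml -sumrMnl -sumrB; apply: eq_bigr => v _.
by rewrite !mxE; ring.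
Qed.

Lemma grid_le_coords (a : grid -> R) i : (forall v, 0 <= a v) ->
  0 <= \sum_v a v * (v i)%:R <= (\sum_v a v) * (M i)%:R.
Proof.
move=> a0; apply/andP; split; first by apply: sumr_ge0 => v _; rewrite mulr_ge0.
by rewrite mulr_suml; apply: ler_sum => v _; rewrite ler_wpM2l// ler_nat grid_leM.
Qed.

(** The total mass is the norm whose unit ball is the centred box: in a facet coordinate [i] of [a],
    the point has absolute value exactly the mass of [a] times [M i], while for [b] this product is
    an upper bound. *)
Lemma grid_total_le (a b : grid -> R) : (forall v, 0 <= a v) -> (forall v, 0 <= b v) ->
  grid_simplex (supp a) -> comb pos a = comb pos b -> \sum_v a v <= \sum_v b v.
Proof.
move=> a0 b0 /and3P[_ _ /grid_facetP[i fi]] ab.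
have av v : a v = 0 \/ v \in supp a.
  by have := a0 v; rewrite le_eqVlt inE => /predU1P[]; [left|right].
have := congr1 (fun x : 'rV_m.+1 => x 0 i) ab; rewrite !comb_posE.
have Mi : 0 < (M i)%:R :> R by rewrite ltr0n.
have /andP[bi1 bi2] := grid_le_coords i b0.
rewrite -(ler_pM2r Mi); case: fi => fi.
  rewrite [X in X *+ 2 - _ = _ -> _]big1 => [|v _]; first by lra.
  by case: (av v) => [->|/fi ->]; rewrite ?mul0r ?mulr0.
rewrite [X in X *+ 2 - _ = _ -> _](_ : _ = (\sum_v a v) * (M i)%:R); first by lra.
rewrite mulr_suml; apply: eq_bigr => v _.
by case: (av v) => [->|/fi ->]; rewrite ?mul0r.
Qed.

Definition up_set w : {set grid} := [set v : grid | [forall i, w i <= v i]%N]%SET.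

(** Along a chain the sets of support vertices with [w i <= v i] are nested. The smallest of them is
    contained in all the others, so it is the part of the support inside [up_set w]. *)
Lemma up_mass (a : grid -> R) w : (forall v, 0 <= a v) -> grid_chain (supp a) ->
  (forall i, \sum_(v in up_set w) a v <= \sum_(v : grid | (w i <= v i)%N) a v) /\
  exists i, \sum_(v in up_set w) a v = \sum_(v : grid | (w i <= v i)%N) a v.
Proof.
move=> a0 /grid_chainP ca; split=> [i|].
  rewrite [leRHS](bigID (fun v => v \in up_set w))/=.
  rewrite [X in _ <= X + _](_ : _ = \sum_(v in up_set w) a v);
    first by rewrite lerDl sumr_ge0.
  apply: eq_bigl => v; rewrite inE; apply/andb_idl => /forallP; exact.
pose A i := [set v in supp a | w i <= v i]%N%SET.
have nest i j : (A i \subset A j) || (A j \subset A i).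
  apply/negPn/negP; rewrite negb_or => /andP[/fintype.subsetPn[v + vj]
    /fintype.subsetPn[u + ui]].
  rewrite !inE in vj ui *; move=> /andP[va wvi] /andP[ua wuj].
  rewrite va /= -ltnNge in vj; rewrite ua /= -ltnNge in ui.
  have := ca u v; rewrite !inE => /(_ ua va) /orP[]/grid_stepP st.
    have /andP[uvj _] := st j.
    by have := leq_ltn_trans (leq_trans wuj uvj) vj; rewrite ltnn.
  have /andP[vui _] := st i.
  by have := leq_ltn_trans (leq_trans wvi vui) ui; rewrite ltnn.
have [i imin] : exists i, forall j, (#|A i| <= #|A j|)%N.
  exists (arg_min (ord0 : 'I_m.+1) predT (fun i => #|A i|)).
  by case: arg_minnP => // k _ h j; exact: h.
exists i.
have Ai j : A i \subset A j.
  have [|/negbTE h] := boolP (A i \subset A j) => //.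
  have := nest i j; rewrite h /= => ji.
  have AE : A j = A i by apply/eqP; rewrite finset.eqEcard ji imin.
  by move: h; rewrite AE fintype.subxx.
rewrite [RHS](bigID (fun v => v \in up_set w))/= [X in _ = _ + X]big1 ?addr0.
  apply: eq_bigl => v; rewrite inE; apply/esym/andb_idl => /forallP; exact.
move=> v /andP[wv]; have := a0 v; rewrite le_eqVlt => /predU1P[//|va].
case/negP; rewrite inE; apply/forallP => j.
have /fintype.subsetP/(_ v) := Ai j; rewrite !inE va wv /=; exact.
Qed.

(* Chain coordinates are recovered from the masses of up-sets by Moebius inversion, and the
   mass of an up-set is the least of the masses of the half-spaces w i <= v i, which
   depend only on the point represented. *)
Lemma grid_fan_unique (a b : grid -> R) : (forall v, 0 <= a v) -> (forall v, 0 <= b v) ->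
  grid_simplex (supp a) -> grid_simplex (supp b) -> comb pos a = comb pos b ->
  forall v, a v = b v.
Proof.
move=> a0 b0 sa sb ab.
have sab : \sum_v a v = \sum_v b v.
  by apply/le_anti/andP; split; apply: grid_total_le.
have Pab i : \sum_v a v * (v i)%:R = \sum_v b v * (v i)%:R.
  have := congr1 (fun x : 'rV_m.+1 => x 0 i) ab; rewrite !comb_posE sab; lra.
have [/and3P[_ ca _] /and3P[_ cb _]] := conj sa sb.
have spread (c : grid -> R) i : grid_chain (supp c) ->
    forall u v, 0 < c u -> 0 < c v -> (u i <= (v i).+1)%N.
  move=> /grid_chainP h u v cu cv; have := h u v; rewrite !inE => /(_ cu cv).
  by move=> /orP[]/grid_stepP/(_ i); lia.
have Ui w i : \sum_(v : grid | (w i <= v i)%N) a v = \sum_(v : grid | (w i <= v i)%N) b v.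
  rewrite (upper_mass_clamp (f := fun v : grid => v i) a0 (spread _ _ ca)).
  by rewrite (upper_mass_clamp (f := fun v : grid => v i) b0 (spread _ _ cb)) sab Pab.
have U w : \sum_(v in up_set w) a v = \sum_(v in up_set w) b v.
  have [lea [i ia]] := up_mass w a0 ca; have [leb [j jb]] := up_mass w b0 cb.
  by apply/le_anti/andP; split; [rewrite jb -Ui|rewrite ia Ui].
(* The vertices strictly above [w] have smaller up-sets, so their coefficients already agree and
   cancel. *)
move=> w; have [n] := ubnP #|up_set w|; elim: n w => // n IH w; rewrite ltnS => wn.
have ww : w \in up_set w by rewrite inE; apply/forallP.
have := U w; rewrite (bigD1 w)//= [in RHS](bigD1 w)//=.
rewrite (eq_bigr b) => [/addIr//|v /andP[vw nvw]]; apply: IH.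
apply: leq_trans wn; apply: proper_card; apply/fintype.properP; split.
  apply/fintype.subsetP => u; rewrite !inE in vw * => /forallP vu; apply/forallP => i.
  exact: leq_trans (forallP vw i) (vu i).
exists w => //; rewrite inE; apply: contra nvw => /forallP vw'; rewrite inE in vw.
apply/eqP/ffunP => i; apply/val_inj/eqP; rewrite eqn_leq /= vw'.
by have /forallP := vw; apply.
Qed.

(** Division by the box norm [s] moves [x] to the boundary of the box. There it is the base corner
    [k] of a unit cube plus a remainder [f] in [0, 1]^(m+1), and the order coordinates of [f],
    scaled by [s], are the coefficients. *)
Lemma grid_fan_cover (x : 'rV[R]_m.+1) : x != 0 -> exists a : grid -> R,
  [/\ forall v, 0 <= a v, grid_simplex (supp a) & x = comb pos a].
Proof.
move=> x0; have MR i : 0 < (M i)%:R :> R by rewrite ltr0n.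
pose i0 := [arg max_(i > ord0) `|x 0 i| / (M i)%:R]%O.
have xmax i : `|x 0 i| / (M i)%:R <= `|x 0 i0| / (M i0)%:R.
  by rewrite /i0; case: arg_maxP => // j _; exact.
pose s := `|x 0 i0| / (M i0)%:R; have s0 : 0 < s.
  have [i xi] : exists i, x 0 i != 0.
    apply: contrapT => n; move/eqP: x0; apply; apply/rowP => i; rewrite mxE.
    by apply: contrapT => /eqP xi; apply: n; exists i.
  by apply: lt_le_trans (xmax i); rewrite divr_gt0// normr_gt0.
have xs i : `|x 0 i| <= s * (M i)%:R by rewrite -ler_pdivrMr// xmax.
pose q i := (x 0 i / s + (M i)%:R) / 2.
have qs i : s * q i = (x 0 i + s * (M i)%:R) / 2.
  by rewrite /q; field; rewrite gt_eqF.
have q0 i : 0 <= q i.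
  by rewrite -(pmulr_rge0 _ s0) qs; have := xs i; rewrite ler_norml; lra.
have qM i : q i <= (M i)%:R.
  by rewrite -(ler_pM2l s0) qs; have := xs i; rewrite ler_norml; lra.
pose k i := Num.truncn (q i); pose f i := q i - (k i)%:R.
have kq i : (k i)%:R <= q i < (k i).+1%:R by exact: truncn_itv.
have f01 i : 0 <= f i <= 1 by rewrite /f; have := kq i; rewrite -natr1; lra.
have [t [t0 ts tf tc]] := order_coordinates ler01 f01.
have kM i : (k i <= M i)%N.
  by rewrite -(ler_nat R); have /andP[+ _] := kq i; move/le_trans; apply.
(* If [k i] equals [M i] and [i] lies in [S], then [inord] falls back to 0; by [kB] this cannot
   happen for a set that carries weight. *)
pose vtx (S : {set 'I_m.+1}) : grid := [ffun i => inord (k i + (i \in S))].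
have tSf S i : 0 < t S -> i \in S -> 0 < f i.
  move=> tS iS; rewrite -tf (bigD1 S)//=; apply: ltr_pwDl => //.
  by apply: sumr_ge0 => ? _; exact: t0.
have kf i : 0 < f i -> (k i < M i)%N.
  by rewrite subr_gt0 -(ltr_nat R) => /lt_le_trans; apply.
have kB (B : {set 'I_m.+1}) i : 0 < t B -> (k i + (i \in B) < (M i).+1)%N.
  move=> tB; have [iB|_] := boolP (i \in B); last by rewrite addn0 ltnS.
  by rewrite addn1 ltnS; exact/kf/tSf/iB.
have vtxE : forall (B : {set 'I_m.+1}) i, 0 < t B ->
    vtx B i = (k i + (i \in B))%N :> nat.
  by move=> B i tB; rewrite ffunE inordK // kB.
pose a v := s * \sum_(S | vtx S == v) t S.
have a0 v : 0 <= a v by apply: mulr_ge0; [exact: ltW|apply: sumr_ge0].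
have aS v : v \in supp a -> exists2 S, 0 < t S & v = vtx S.
  rewrite inE pmulr_rgt0// => av; apply: contrapT => n; move: av.
  rewrite big1 ?ltxx// => S /eqP Sv; apply/eqP; rewrite eq_le t0 andbT leNgt.
  by apply/negP => tS; apply: n; exists S.
have asum (g : grid -> R) : \sum_v a v * g v = s * \sum_S t S * g (vtx S).
  rewrite (partition_big vtx predT)//= mulr_sumr; apply: eq_bigr => v _.
  rewrite -mulrA mulr_suml; congr (_ * _); apply: eq_bigr => S /eqP ->//.
have st : \sum_v a v = s.
  have := asum (fun=> 1); under eq_bigr do rewrite mulr1.
  by under [X in _ = _ * X]eq_bigr do rewrite mulr1; rewrite ts mulr1.
exists a; split=> //.
- apply/and3P; split.
  + apply/eqP => sa; suff sz : \sum_v a v = 0 by rewrite sz in st; rewrite st ltxx in s0.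
    apply: big1 => v _; apply/eqP; rewrite eq_le a0 andbT leNgt.
    by have /setP/(_ v) := sa; rewrite !inE => ->.
  + apply/grid_chainP => u v /aS[S tS ->] /aS[T tT ->].
    have step S' T' : 0 < t S' -> 0 < t T' -> S' \subset T' -> grid_step (vtx S') (vtx T').
      move=> tS' tT' /fintype.subsetP ST; apply/grid_stepP => i; rewrite !vtxE//.
      move: (ST i); case: (i \in S'); case: (i \in T') => h;
        rewrite ?addn1 ?addn0 ?leqnn ?leqnSn //; by have := h isT.
    by apply/orP; have /orP[ST|ST] := tc S T tS tT; [left|right]; exact: step.
  + apply/grid_facetP; exists i0.
    have xi0 : `|x 0 i0| = s * (M i0)%:R by rewrite /s divfK// gt_eqF.
    (* When [q i0] is an integer, [f i0] is 0 and no weighted set contains [i0]. This is the facet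
       coordinate, since the norm is attained there. *)
    have kE v : v \in supp a -> q i0 = (k i0)%:R -> v i0 = k i0 :> nat.
      move=> /aS[S tS ->] qk; rewrite vtxE//; case: (boolP (i0 \in S)) => [iS|_];
        last by rewrite addn0.
      by have := tSf S i0 tS iS; rewrite /f qk subrr ltxx.
    have [x1|x1] := leP 0 (x 0 i0); [right|left] => v va.
      have qE : q i0 = (M i0)%:R.
        by apply: (mulfI (lt0r_neq0 s0)); rewrite qs -xi0 ger0_norm//; lra.
      by rewrite kE// /k qE natrK.
    have qE : q i0 = 0.
      by apply: (mulfI (lt0r_neq0 s0)); rewrite qs -xi0 ltr0_norm// mulr0; lra.
    by rewrite kE// /k qE ?truncn0.
- apply/rowP => i; rewrite comb_posE st asum.
  rewrite (_ : \sum_S _ = q i); first by rewrite qs; lra.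
  rewrite (eq_bigr (fun S => t S * (k i)%:R + (if i \in S then t S else 0))).
    by rewrite big_split/= -mulr_suml ts -big_mkcond tf /f; ring.
  move=> S _; have := t0 S; rewrite le_eqVlt => /predU1P[<-|tS].
    by rewrite !mul0r if_same addr0.
  by rewrite vtxE// natrD mulrDr; case: (i \in S); rewrite ?mulr1 ?mulr0.
Qed.

End grid_fan.

(** * Sign changes of iterated differences *)

Section alternation.
Implicit Types (z : nat -> int) (d s : int).

(** Prepending a zero makes [diff z j] equal to z j - z (j - 1), with value z 0 at j = 0, so the
    jump from 0 to the first entry is recorded as well. *)
Definition shift z (j : nat) : int := if j is i.+1 then z i else 0.
Definition diff z (j : nat) : int := shift z j.+1 - shift z j.

Fixpoint alternates d z (a : nat) s (lo : nat) : Prop :=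
  if a is b.+1 then
    exists p, [/\ (lo <= p)%N, d < s * z p & alternates d z b (- s) p.+1]
  else True.

Lemma alternates_weaken d z a s lo lo' : (lo' <= lo)%N ->
  alternates d z a s lo -> alternates d z a s lo'.
Proof.
by case: a => //= a lo'lo [p [lop dp ap]]; exists p; split=> //; exact: leq_trans lop.
Qed.

(** The increment telescopes into [c] differences, one of which is at least the average. *)
Lemma diff_pigeonhole d z s lo c :
  c%:Z * d < s * (shift z (lo + c) - shift z lo) ->
  exists q, [/\ (lo <= q)%N, (q < lo + c)%N & d < s * diff z q].
Proof.
elim: c => [|c IH]; first by rewrite mul0r addn0 subrr mulr0 ltxx.
have [dq|dq] := ltP d (s * diff z (lo + c)).
  by exists (lo + c)%N; rewrite leq_addr addnS ltnS leqnn.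
move: dq; rewrite /diff addnS => dq h.
have [|q [q1 q2 q3]] := IH.
  by move: dq h; rewrite !mulrBr intS mulrDl mul1r; lia.
by exists q; split=> //; exact: ltnW.
Qed.

(** The bound on [shift z lo] says that the entry before [lo] is large with sign opposite to [s].
    Each alternating entry yields one jump, and the final return to 0 beyond the support yields the
    additional one. A jump takes at most L + 1 steps, whence the factor. *)
Lemma alternates_diff_from d z a s lo L : 0 <= d ->
  (forall j, (L <= j)%N -> z j = 0) ->
  s * shift z lo < - (L.+1%:Z * d) -> alternates (L.+1%:Z * d) z a s lo ->
  alternates d (diff z) a.+1 s lo.
Proof.
move=> d0 zL; have bound c : (c <= L.+1)%N -> c%:Z * d <= L.+1%:Z * d.
  by move=> cL; rewrite ler_wpM2r// lez_nat.
have Ld : 0 <= L.+1%:Z * d by rewrite mulr_ge0.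
have shiftL c : (L < c)%N -> shift z c = 0 by case: c => // c; exact: zL.
elim: a s lo => [|a IH] s lo slo.
  move=> _; have loL : (lo <= L)%N.
    rewrite leqNgt; apply/negP => /shiftL zl; move: slo; rewrite zl mulr0; lia.
  have [|q [q1 q2 q3]] := @diff_pigeonhole d z s lo (L.+1 - lo).
    apply: le_lt_trans (bound _ (leq_subr _ _)) _.
    by rewrite subnKC ?leqW// shiftL// sub0r mulrN; lia.
  by exists q.
move=> [p [lop dp ap]].
have pL : (p < L)%N.
  by rewrite ltnNge; apply/negP => /zL zp; move: dp; rewrite zp mulr0; lia.
have [|q [q1 q2 q3]] := @diff_pigeonhole d z s lo (p.+1 - lo).
  apply: le_lt_trans (bound _ _) _; first by lia.
  by rewrite subnKC ?leqW// mulrBr /=; lia.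
exists q; split=> //; apply: (@alternates_weaken _ _ _ _ p.+1).
  by lia.
by apply: IH => //=; rewrite mulNr; lia.
Qed.

(** The climb from the prepended zero to the first large entry is one more jump, so b entries give b
    + 1: the ascent, the b - 1 passages between them, and the return to 0. *)
Lemma alternates_diff d z a s L : 0 <= d ->
  (forall j, (L <= j)%N -> z j = 0) ->
  alternates (L.+1%:Z * d) z a.+1 s 0 -> alternates d (diff z) a.+2 s 0.
Proof.
move=> d0 zL [p [_ dp ap]].
have Ld : 0 <= L.+1%:Z * d by rewrite mulr_ge0.
have pL : (p < L)%N.
  by rewrite ltnNge; apply/negP => /zL zp; move: dp; rewrite zp mulr0; lia.
have [|q [q1 q2 q3]] := @diff_pigeonhole d z s 0 p.+1.
  rewrite subr0; apply: le_lt_trans dp.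
  by rewrite ler_wpM2r// lez_nat; lia.
exists q; split=> //; apply: (@alternates_weaken _ _ _ _ p.+1) => //.
by apply: alternates_diff_from ap => //=; rewrite mulNr; lia.
Qed.

Lemma alternates_le d d' z a s lo : d' <= d -> alternates d z a s lo ->
  alternates d' z a s lo.
Proof.
move=> dd; elim: a s lo => //= a IH s lo [p [lop dp ap]].
by exists p; split=> //; [exact: le_lt_trans dp|exact: IH].
Qed.

Lemma diff_support z L : (forall j, (L <= j)%N -> z j = 0) ->
  forall j, (L < j)%N -> diff z j = 0.
Proof. by move=> zL [//|j] Lj; rewrite /diff /= !zL// ltnW. Qed.

Lemma iter_diff_support z L r : (forall j, (L <= j)%N -> z j = 0) ->
  forall j, (L + r <= j)%N -> iter r diff z j = 0.
Proof.
move=> zL; elim: r => [|r IH] j; first by rewrite addn0; exact: zL.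
by rewrite addnS; exact: diff_support.
Qed.

(* Descartes' rule of signs in quantitative form: every difference creates a new
   sign change, at the cost of a factor n in the threshold. *)
Lemma alternates_iter_diff n d z a s L r : 0 <= d -> (L + r <= n)%N ->
  (forall j, (L <= j)%N -> z j = 0) ->
  alternates (n%:Z ^+ r * d) z a.+1 s 0 -> alternates d (iter r diff z) (a + r).+1 s 0.
Proof.
elim: r d => [|r IH] d d0 Lr zL; first by rewrite expr0 mul1r addn0.
rewrite exprSr -mulrA addnS iterS => /IH al.
apply: alternates_diff => //; first exact: iter_diff_support zL.
apply: alternates_le (al _ _ _) => //; [|by rewrite mulr_ge0|by lia].
by rewrite ler_wpM2r// lez_nat; lia.
Qed.

(** [diff] is additive, and a difference of two entries at most doubles a uniform bound. *)
Lemma iter_diff_bound z z' r B : (forall j, `|z j + z' j| <= B) ->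
  forall j, `|iter r diff z j + iter r diff z' j| <= 2 ^+ r * B.
Proof.
move=> zz; have B0 : 0 <= B by apply: le_trans (zz 0%N).
elim: r => [|r IH] j; first by rewrite expr0 mul1r.
have sh i : `|shift (iter r diff z) i + shift (iter r diff z') i| <= 2 ^+ r * B.
  by case: i => [|i] //=; rewrite addr0 normr0 mulr_ge0// exprn_ge0.
rewrite !iterS /diff; have := sh j; have := sh j.+1.
rewrite exprS -mulrA /=; set c := _ * B; clearbody c.
set u := shift _ _; set v := shift _ _; set u' := iter _ _ _ _; set v' := iter _ _ _ _; lia.
Qed.

End alternation.

(** * Stable sets from alternating sequences *)

Section gale.
Variables (n : nat) (d : int) (y : nat -> int).
Hypothesis d0 : 0 <= d.
Hypothesis y_supp : forall j, (n <= j)%N -> y j = 0.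

(** The first entry of each pair is chosen. The negative entry after it separates it from the next
    choice and, at the end, keeps the position n - 1 free, so no choice is cyclically followed by
    0. *)
Lemma sparse_set_pos k lo : alternates d y k.*2 1 lo ->
  exists A : {set 'I_n}, #|A| = k /\ forall i, i \in A ->
    [/\ (lo <= i)%N, (i.+1 < n)%N, d < y i & forall j, j \in A -> j <> i.+1 :> nat].
Proof.
elim: k lo => [|k IH] lo; first by exists finset.set0; rewrite cards0; split=> // i;
  rewrite inE.
rewrite doubleS => -[p [lop dp [p' [pp' dp' ap]]]].
have p'n : (p' < n)%N.
  by rewrite ltnNge; apply/negP => /y_supp yp; move: dp'; rewrite yp mulr0; lia.
have [A [Ak AP]] : exists A : {set 'I_n}, #|A| = k /\ forall i, i \in A ->
    [/\ (p'.+1 <= i)%N, (i.+1 < n)%N, d < y i & forall j, j \in A -> j <> i.+1 :> nat].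
  by apply: IH; rewrite opprK in ap.
have pn : (p < n)%N by lia.
exists (Ordinal pn |: A)%SET; split.
  rewrite cardsU1 Ak; have [/AP[/= h]|] := boolP (Ordinal pn \in A) => //; lia.
move=> i; rewrite !inE => /predU1P[->|iA].
  split=> //=; [lia|by rewrite mul1r in dp|] => j; rewrite !inE => /predU1P[->/=|/AP[h]];
    lia.
have [h1 h2 h3 h4] := AP i iA; split=> //; first by lia.
by move=> j; rewrite !inE => /predU1P[->/=|]; [lia|exact: h4].
Qed.

(** Here the second entry of each pair is chosen; the negative entry before it gives [lo < i], which
    keeps position 0 free and settles the cyclic wrap. *)
Lemma sparse_set_neg k lo : alternates d y k.*2 (- 1) lo ->
  exists A : {set 'I_n}, #|A| = k /\ forall i, i \in A ->
    [/\ (lo < i)%N, d < y i & forall j, j \in A -> j <> i.+1 :> nat].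
Proof.
elim: k lo => [|k IH] lo; first by exists finset.set0; rewrite cards0; split=> // i;
  rewrite inE.
rewrite doubleS => -[p [lop dp [p' [pp' dp' ap]]]].
have p'n : (p' < n)%N.
  by rewrite ltnNge; apply/negP => /y_supp yp; move: dp'; rewrite yp mulr0; lia.
have [A [Ak AP]] : exists A : {set 'I_n}, #|A| = k /\ forall i, i \in A ->
    [/\ (p'.+1 < i)%N, d < y i & forall j, j \in A -> j <> i.+1 :> nat].
  by apply: IH; rewrite opprK in ap.
exists (Ordinal p'n |: A)%SET; split.
  rewrite cardsU1 Ak; have [/AP[/= h]|] := boolP (Ordinal p'n \in A) => //; lia.
move=> i; rewrite !inE => /predU1P[->|iA].
  split=> //=; [lia|by rewrite opprK mul1r in dp'|] => j; rewrite !inE =>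
    /predU1P[->/=|/AP[h]]; lia.
have [h1 h2 h3] := AP i iA; split=> //; first by lia.
by move=> j; rewrite !inE => /predU1P[->/=|]; [lia|exact: h3].
Qed.

Lemma stable_set_exists k s : (1 < n)%N -> s = 1 \/ s = - 1 -> alternates d y k.*2 s 0 ->
  exists A : schrijver_vertex n k, forall i, i \in val A -> d < y i.
Proof.
move=> n1 sE al.
suff [A [Ak st Ay]] : exists A : {set 'I_n}, [/\ #|A| = k, stable A &
    forall i, i \in A -> d < y i].
  have AP : (#|A| == k) && stable A by rewrite Ak eqxx.
  by exists (Sub A AP) => i; rewrite SubK; exact: Ay.
case: sE al => -> al.
  have [A [Ak AP]] := sparse_set_pos al; exists A; split=> // [|i /AP[]//].
  apply/forall_inP => i /AP[_ i1 _ h]; apply/negP => /h; apply.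
  by rewrite /= modn_small.
have [A [Ak AP]] := sparse_set_neg al; exists A; split=> // [|i /AP[]//].
apply/forall_inP => i /[dup] iA /AP[_ _ h]; apply/negP => /[dup] /AP[+ _ _] /h.
rewrite /=; have [i1|i1] := ltnP i.+1 n; first by rewrite modn_small.
by have -> : i.+1 = n; [have := ltn_ord i; lia|rewrite modnn].
Qed.

End gale.

(** * The quadrangulation *)

Section box_quadrangulation.
Variables (R : realType) (m : nat) (M : 'I_m.+1 -> nat).
Hypothesis m0 : (0 < m)%N.
Hypothesis M3 : forall i, (2 < M i)%N.
Hypothesis M_odd : odd (\sum_i M i).
Local Notation grid := (grid M).
Implicit Types (u v w x : grid) (s : {set grid}).

Lemma box_M0 i : (0 < M i)%N. Proof. by rewrite (leq_trans _ (M3 i)). Qed.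

Definition parity v := odd (\sum_i v i).

Lemma parity_rev v : parity (grid_rev v) = ~~ parity v.
Proof.
have : (\sum_i grid_rev v i + \sum_i v i = \sum_i M i)%N.
  by rewrite -big_split; apply: eq_bigr => i _; rewrite /= grid_revE subnK// grid_leM.
move=> /(congr1 odd); rewrite oddD M_odd /parity.
by case: (odd _); case: (odd _).
Qed.

Definition grid_inc v j : grid := [ffun i => inord (v i + (i == j))].

Lemma grid_incE v j i : (v j < M j)%N -> grid_inc v j i = (v i + (i == j))%N :> nat.
Proof.
move=> vj; rewrite ffunE inordK//; have [->|_] := eqVneq i j; first by rewrite addn1 ltnS.
by rewrite addn0.
Qed.

Lemma parity_inc v j : (v j < M j)%N -> parity (grid_inc v j) = ~~ parity v.
Proof.
move=> vj; rewrite /parity (eq_bigr (fun i => v i + (i == j))%N) => [|i _];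
  last exact: grid_incE.
by rewrite big_split/= -big_mkcond /= big_pred1_eq addn1.
Qed.

Lemma grid_step_inc v j : (v j < M j)%N -> grid_step v (grid_inc v j).
Proof. by move=> vj; apply/grid_stepP => i; rewrite grid_incE//; case: (i == j); lia. Qed.

Lemma grid_step_refl v : grid_step v v.
Proof. by apply/grid_stepP => i; rewrite leqnn leqnSn. Qed.

Lemma grid_simplex_inc v i j : i != j -> (v j < M j)%N -> v i = 0%N :> nat \/ v i = M i
  :> nat ->
  grid_simplex [set v; grid_inc v j]%SET.
Proof.
move=> ij vj vi; apply/and3P; split.
- by apply/finset.set0Pn; exists v; rewrite !inE eqxx.
- apply/grid_chainP => x y; rewrite !inE => /orP[]/eqP -> /orP[]/eqP ->;
    by rewrite ?grid_step_refl ?grid_step_inc// orbT.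
- apply/grid_facetP; exists i; case: vi => vi; [left|right] => x;
    by rewrite !inE => /orP[]/eqP -> //; rewrite grid_incE// (negbTE ij) addn0.
Qed.

(** In a facet coordinate [v] and its antipode lie at distance [M i], at least 3, which two steps
    through [x] cannot bridge. *)
Lemma far_antipodes x v : grid_simplex [set v]%SET ->
  grid_step x v || grid_step v x ->
  grid_step x (grid_rev v) || grid_step (grid_rev v) x -> False.
Proof.
move=> /and3P[_ _ /grid_facetP[i fi]] xv xrv.
have vi : v i = 0%N :> nat \/ v i = M i :> nat by case: fi => fi; [left|right];
  apply: fi; rewrite inE.
have := M3 i; have := grid_leM v i; move: vi.
by case/orP: xv => /grid_stepP/(_ i); case/orP: xrv => /grid_stepP/(_ i);
  rewrite !grid_revE; lia.
Qed.

Lemma other_coordinate (i : 'I_m.+1) : exists j, j != i.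
Proof.
have [->|i0] := eqVneq i ord0; last by exists ord0; rewrite eq_sym.
by exists ord_max; rewrite -val_eqE /= -lt0n.
Qed.

Lemma grid_sum_step u v : grid_step u v || grid_step v u -> (\sum_i u i <= \sum_i v i)%N ->
  grid_step u v.
Proof.
case/orP => // /grid_stepP vu uv; suff -> : u = v by exact: grid_step_refl.
have vui i : (v i <= u i)%N by have /andP[] := vu i.
apply/ffunP => i; apply/val_inj/eqP; rewrite eqn_leq vui andbT /= leqNgt.
apply/negP => vi; move: uv; rewrite leqNgt => /negP; apply.
by rewrite (bigD1 i)//= [ltnRHS](bigD1 i)//= -addSn leq_add// leq_sum.
Qed.

Lemma grid_simplex_point s v : grid_simplex s -> v \in s -> grid_simplex [set v]%SET.
Proof.
move=> ss vs; apply: grid_simplex_sub ss _ _; first by rewrite finset.sub1set.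
by rewrite -card_gt0 cards1.
Qed.

(* A step of the chain that changes two or more coordinates has room for a midpoint; a
   single vertex has a neighbour along any edge inside its facet. *)
Lemma monochromatic_extends s b : grid_simplex s -> (forall v, v \in s -> parity v = b) ->
  exists2 t : {set grid}, grid_simplex t & s \proper t.
Proof.
move=> ss sb; have /and3P[s0 /grid_chainP cs /grid_facetP[i fi]] := ss.
have ext w : grid_simplex (w |: s)%SET -> parity w != b ->
    exists2 t : {set grid}, grid_simplex t & s \proper t.
  move=> ws wb; exists (w |: s)%SET => //; apply/fintype.properP; split;
    first exact: finset.subsetUr.
  by exists w; rewrite ?setU11//; apply: contra wb => /sb ->.
have /finset.set0Pn[v0 v0s] := s0.
(* The coordinate sum is strictly increasing along a chain, so minimising it finds the least vertex
   [u] and later, with [u] excluded, its successor [v]. *)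
have [u us umin] : exists2 u, u \in s & forall v, v \in s -> (\sum_i u i <= \sum_i v i)%N.
  exists (arg_min v0 (fun v => v \in s) (fun v => \sum_i v i)%N); by case: arg_minnP.
have [su|] := eqVneq s [set u]%SET.
  have [j ji] := other_coordinate i.
  have ui : u i = 0%N :> nat \/ u i = M i :> nat by case: fi => fi; [left|right]; exact: fi.
  have [uj|uj] := ltnP (u j) (M j).
    apply: (ext (grid_inc u j)); last by rewrite parity_inc// sb//; case: b {sb ext}.
    by rewrite su finset.setUC; apply: (@grid_simplex_inc _ i); rewrite // eq_sym.
  (* In direction [j] the vertex [u] is at the upper end of the box, so the neighbour is taken below
     it. *)
  pose w : grid := [ffun i => inord (u i - (i == j))].
  have wE l : w l = (u l - (l == j))%N :> nat.
    by rewrite ffunE inordK// ltnS (leq_trans (leq_subr _ _))// grid_leM.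
  have Mj := M3 j; have uM := grid_leM u j.
  have wj : (w j < M j)%N by rewrite wE eqxx; lia.
  have uE : u = grid_inc w j.
    apply/ffunP => l; apply/val_inj; rewrite /= grid_incE// wE.
    have [->|_] := eqVneq l j; last by rewrite subn0 addn0.
    by rewrite subnK// (leq_trans _ uj)// ltnW// ltnW.
  apply: (ext w); last by have := sb u us; rewrite {1}uE parity_inc// => <-; case: parity.
  rewrite su uE; apply: (@grid_simplex_inc _ i); rewrite ?(eq_sym i)//.
  by rewrite wE eq_sym (negbTE ji) subn0.
move=> su; have [v1 v1s] : exists v, (v \in s) && (v != u).
  apply: contrapT => n; case/eqP: su; apply/setP => v; rewrite inE.
  have [->|vu] := eqVneq v u; first by rewrite us.
  by apply/negbTE/negP => vs; apply: n; exists v; rewrite vs.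
have [v /andP[vs vu] vmin] : exists2 v, (v \in s) && (v != u) &
    forall x, (x \in s) && (x != u) -> (\sum_i v i <= \sum_i x i)%N.
  exists (arg_min v1 (fun v => (v \in s) && (v != u)) (fun v => \sum_i v i)%N);
    by case: arg_minnP.
have ux x : x \in s -> grid_step u x.
  by move=> xs; apply: grid_sum_step; [exact: cs|exact: umin].
have vx x : x \in s -> x != u -> grid_step v x.
  by move=> xs xu; apply: grid_sum_step; [exact: cs|apply: vmin; rewrite xs].
(* Raising [u] in a coordinate where [v] exceeds it gives a vertex between [u] and the rest of the
   chain; its parity shows that it is new. *)
have [j uvj] : exists j, (u j < v j)%N.
  apply: contrapT => n; case/eqP: vu; apply/ffunP => j; apply/val_inj/eqP.
  have /grid_stepP/(_ j)/andP[uv _] := ux v vs.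
  by rewrite eqn_leq uv andbT leqNgt; apply/negP => h; apply: n; exists j.
have uj : (u j < M j)%N by rewrite (leq_trans uvj) ?grid_leM.
apply: (ext (grid_inc u j)); last by rewrite parity_inc// sb//; case: b {sb ext}.
have wv x : x \in s -> x != u -> grid_step (grid_inc u j) x.
  move=> xs xu; apply/grid_stepP => l; rewrite grid_incE//.
  have /grid_stepP/(_ l)/andP[ul xl] := ux x xs.
  have [lj|_] := eqVneq l j; last by rewrite addn0 ul.
  have /grid_stepP/(_ j)/andP[vj _] := vx x xs xu.
  by rewrite addn1 (leqW xl) andbT lj (leq_trans uvj vj).
have wx x : x \in s -> grid_step (grid_inc u j) x || grid_step x (grid_inc u j).
  by move=> xs; have [->|/wv->//] := eqVneq x u; rewrite grid_step_inc ?orbT.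
apply/and3P; split.
- by apply/finset.set0Pn; exists u; rewrite inE us orbT.
- apply/grid_chainP => x y; rewrite !inE => /predU1P[->|xs] /predU1P[->|ys].
  + by rewrite grid_step_refl.
  + exact: wx.
  + by rewrite orbC wx.
  + exact: cs.
- have ij : i != j.
    by apply: contraTneq uvj => <-; case: fi => fi; rewrite !fi ?ltnn.
  apply/grid_facetP; exists i; case: fi => fi; [left|right] => x;
    by rewrite !inE => /predU1P[->|/fi//]; rewrite grid_incE// (negbTE ij) addn0 fi.
Qed.

Definition grid_corner (t : nat) : grid := [ffun i : 'I_m.+1 =>
  inord (if (i < t)%N then M i else 0)].

Lemma grid_cornerE t i : grid_corner t i = (if (i < t)%N then M i else 0)%N :> nat.
Proof. by rewrite ffunE inordK//; case: ifP. Qed.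

(** Coordinates are raised from 0 to [M i] one after another. While one moves, any other is at an
    end of its range, so every edge of the path lies in a facet; such a second coordinate exists
    because m > 0. *)
Lemma grid_corner_walk (P : grid -> Prop) : P (grid_corner 0) ->
  (forall v j, (v j < M j)%N -> grid_simplex [set v; grid_inc v j]%SET ->
     P v -> P (grid_inc v j)) ->
  P (grid_corner m.+1).
Proof.
move=> P0 PS; suff Pt t : (t <= m.+1)%N -> P (grid_corner t) by exact: Pt.
elim: t => // t IH tm; have {}IH := IH (ltnW tm).
pose j : 'I_m.+1 := Ordinal tm.
pose w (b : nat) : grid :=
  [ffun i : 'I_m.+1 => inord (if i == j then b else grid_corner t i : nat)].
have wE b i : (b <= M j)%N -> w b i = (if i == j then b else grid_corner t i : nat) :> nat.
  move=> bM; rewrite ffunE inordK//; have [->|_] := eqVneq i j; first by rewrite ltnS.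
  by [].
suff Pb b : (b <= M j)%N -> P (w b).
  rewrite (_ : grid_corner t.+1 = w (M j)); first exact: Pb.
  apply/ffunP => i; apply/val_inj; rewrite /= wE// !grid_cornerE ltnS leq_eqVlt -val_eqE /=.
  by have [it|//] := eqVneq (i : nat) t; rewrite (_ : i = j)//; exact: val_inj.
elim: b => [_|b IHb bM].
  rewrite (_ : w 0%N = grid_corner t)//; apply/ffunP => i; apply/val_inj.
  rewrite /= wE//; have [->|//] := eqVneq i j; by rewrite grid_cornerE ltnn.
have wj : (w b j < M j)%N by rewrite wE ?eqxx// ltnW.
have -> : w b.+1 = grid_inc (w b) j.
  apply/ffunP => i; apply/val_inj; rewrite /= grid_incE// !wE ?(ltnW bM)//.
  by case: (i == j); rewrite ?addn1 ?addn0.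
apply: PS => //; last exact: IHb (ltnW bM).
have [i ij] := other_coordinate j.
apply: (@grid_simplex_inc _ i) => //; rewrite wE ?(ltnW bM)// (negbTE ij) grid_cornerE.
by case: ifP; [right|left].
Qed.

Lemma grid_corner_rev : grid_corner m.+1 = grid_rev (grid_corner 0).
Proof.
apply/ffunP => i; apply/val_inj; rewrite /= grid_revE !grid_cornerE ltn_ord subn0//.
Qed.

(** A vertex of [K] is an antipodal pair of grid vertices, and as [grid_rev] flips the parity,
    exactly one of them is even. *)
Lemma card1_vertex (K : cell_space R) (S : cell K -> {set grid}) :
  (forall c, grid_simplex (S c) /\ #|S c| = (cdim c).+1) ->
  exists b : vertex K -> grid, forall u : vertex K,
    [/\ ~~ parity (b u), grid_simplex [set b u]%SET &
        S (val u) = [set b u]%SET \/ S (val u) = opp_set (@grid_rev m M) [set b u]%SET].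
Proof.
move=> Sc; suff /boolp.choice[b bP] : forall u : vertex K, exists v : grid,
    [/\ ~~ parity v, grid_simplex [set v]%SET &
        S (val u) = [set v]%SET \/ S (val u) = opp_set (@grid_rev m M) [set v]%SET].
  by exists b.
move=> u; have [su cu] := Sc (val u).
have /cards1P[v uv] : #|S (val u)| == 1%N by rewrite cu (eqP (valP u)).
rewrite uv in su *; case: (boolP (parity v)) => pv; last by exists v; split=> //; left.
exists (grid_rev v); split.
- by rewrite parity_rev pv.
- by have := grid_simplex_opp su; rewrite /opp_set imset_set1.
- by right; rewrite /opp_set imset_set1 grid_revK.
Qed.

Theorem box_quadrangulation_exists : exists (K : cell_space R) (b : vertex K -> grid),
  let G := fun u v : vertex K => grid_simplex [set b u; grid_rev (b v)]%SET in
  [/\ generalised_simplicial_complex K,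
      homeomorphic (underlying_space K) (projective_space R m),
      quadrangulation G, ~ bipartite G & forall u : vertex K, grid_simplex [set b u]%SET].
Proof.
have [K [S [cK hK [Sc Sinj] Sex Scl]]] := @symmetric_fan_complex R m grid (@grid_rev m M)
  (@grid_pos R m M) (@grid_simplex m M) (@grid_revK m M) (@grid_pos_rev R m M)
  (@grid_simplex0 m M) (@grid_simplex_sub m M) (@grid_simplex_opp m M)
  (fun s v => @grid_simplex_rev m M s v box_M0) (@grid_fan_cover R m M box_M0)
  (@grid_fan_unique R m M box_M0).
have [b bP] := card1_vertex Sc; exists K, b; set G := (fun u v : vertex K => _).
have mem_opp (s : {set grid}) v : (v \in opp_set (@grid_rev m M) s) = (grid_rev v \in s).
  exact: (mem_opp_set (@grid_revK m M)).
have b_even (u : vertex K) : ~~ parity (b u) by have [] := bP u.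
have b_splx (u : vertex K) : grid_simplex [set b u]%SET by have [] := bP u.
have b_inj : injective b.
  move=> u v uv; apply/val_inj/Sinj; have [_ _ Su] := bP u; have [_ _ Sv] := bP v.
  move: Su Sv; rewrite uv; move=> [->|->] [->|->]; rewrite ?(opp_setK (@grid_revK m M));
    by [left|right].
have b_surj v : grid_simplex [set v]%SET -> exists u : vertex K,
  b u = v \/ b u = grid_rev v.
  move=> sv; have [c cE] := Sex _ sv; have [_ cc] := Sc c.
  have c0 : cdim c == 0%N.
    rewrite -eqSS -cc; case: cE => ->; first by rewrite cards1.
    by rewrite (card_opp_set (@grid_revK m M)) cards1.
  exists (Sub c c0); have [_ _] := bP (Sub c c0); rewrite SubK.
  case: cE => ->; rewrite /opp_set ?imset_set1 => -[/finset.set1_inj->|/finset.set1_inj];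
    try by [left|right].
    by move=> ->; right; rewrite grid_revK.
  by move/(can_inj (@grid_revK m M)) => ->; left.
have b_surj_even v : grid_simplex [set v]%SET -> ~~ parity v -> exists u : vertex K,
  b u = v.
  move=> /b_surj[u [uv|uv]] pv; first by exists u.
  by have := b_even u; rewrite uv parity_rev (negbTE pv).
have vsE (c : cell K) (u : vertex K) : (u \in vertex_set c) = (b u \in S c) || (grid_rev
  (b u) \in S c).
  rewrite inE; apply/asboolP/orP; rewrite Scl; have [_ _] := bP u.
    by move=> [->|->]; rewrite ?(opp_setK (@grid_revK m M)) /opp_set imset_set1
      !finset.sub1set => -[]; by [left|right].
  by move=> [->|->]; rewrite ?(opp_setK (@grid_revK m M)) /opp_set imset_set1
    !finset.sub1set => -[]; by [left|right].
have splxP (s : {set grid}) v w : grid_simplex s -> v \in s -> w \in s -> grid_simplex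
  [set v; w]%SET.
  move=> ss vs ws; apply: grid_simplex_sub ss _ _.
    by apply/fintype.subsetP => x; rewrite !inE => /orP[]/eqP ->.
  by apply/finset.set0Pn; exists v; rewrite !inE eqxx.
have splx_step (s : {set grid}) v w : grid_simplex s -> v \in s -> w \in s -> grid_step v
  w || grid_step w v.
  by move=> /and3P[_ /grid_chainP cs _]; exact: cs.
have Gsym : symmetric G.
  suff Gs (u v : vertex K) : G u v -> G v u by move=> u v; apply/idP/idP; exact: Gs.
  by move=> /grid_simplex_opp; rewrite /opp_set imsetU !imset_set1 grid_revK finset.setUC.
have G_step (u v : vertex K) : G u v -> grid_step (b u) (grid_rev (b v)) || grid_step
  (grid_rev (b v)) (b u).
  by move=> uv; apply: splx_step uv _ _; rewrite !inE eqxx ?orbT.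
split=> //.
- split.
  + split=> // u; apply/negP => uu; have := @grid_simplex_rev m M _ (b u) box_M0 uu.
    by rewrite !inE !eqxx orbT => /(_ isT).
  + move=> u v uv; have [c cE] := Sex _ uv; have [_ cc] := Sc c; exists c; split.
      apply/eqP; rewrite -eqSS -cc.
      have -> : #|S c| = #|[set b u; grid_rev (b v)]%SET|.
        by case: cE => -> //; rewrite (card_opp_set (@grid_revK m M)).
      rewrite cards2; suff -> : b u != grid_rev (b v) by [].
      by apply: contraTneq (b_even u) => ->; rewrite parity_rev b_even.
    apply/setP => w; rewrite vsE !inE.
    have nr (x y : vertex K) : (b x == grid_rev (b y)) = false.
      by apply/negbTE; apply: contraTneq (b_even x) => ->; rewrite parity_rev b_even.
    have -> : (b w \in S c) || (grid_rev (b w) \in S c) =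
        (b w \in [set b u; grid_rev (b v)]%SET) || (grid_rev (b w) \in [set b u;
          grid_rev (b v)]%SET).
      by case: cE => -> //; rewrite !mem_opp grid_revK orbC.
    rewrite !inE nr orbF (eq_sym (grid_rev (b w)) (b u)) nr /= (inj_eq (can_inj
      (@grid_revK m M))).
    by rewrite !(inj_eq b_inj).
  + move=> c cmax; have [sc _] := Sc c; split.
      (* The two classes collect the vertices whose even, respectively odd, grid vertex belongs to
         the simplex [S c]. *)
      exists [set u | b u \in S c]%SET, [set u | grid_rev (b u) \in S c]%SET; split.
      * by apply/setP => u; rewrite vsE !inE.
      * rewrite -finset.setI_eq0; apply/eqP/setP => u; rewrite !inE.
        by apply/negbTE/negP => /andP[/(grid_simplex_rev box_M0 sc)/negP].
      * move=> u v; rewrite !vsE !inE => us vs; apply/idP/idP.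
          (* An edge inside one class would give a grid vertex that is close both to a boundary
             vertex and to its antipode. *)
          move=> uv; apply/negPn/negP; rewrite negb_or !negb_and => /andP[h1 h2].
          case/orP: us => us; case/orP: vs => vs; rewrite ?us ?vs //= in h1 h2.
            by apply: (far_antipodes (b_splx v) (splx_step _ _ _ sc us vs)); exact: G_step.
          apply: (@far_antipodes (grid_rev (b v)) (b u) (b_splx u)).
            by rewrite orbC; exact: G_step.
          exact: splx_step sc vs us.
        case/orP=> /andP[uc vc]; first exact: splxP sc uc vc.
        by rewrite -/(G u v) Gsym; exact: splxP sc vc uc.
    (* Otherwise [S c] extends to a larger simplex, whose cell contradicts the maximality of [c]. *)
    have bichromatic p : exists2 x, x \in S c & parity x != p.
      apply: contrapT => n; have [|t st cst] := @monochromatic_extends _ p sc.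
        by move=> v vs; apply/eqP/negPn/negP => pv; apply: n; exists v.
      have [c' c'E] := Sex _ st; have /fintype.properP[ct _] := cst.
      have cc' : closed_simplex c `<=` closed_simplex c'.
        apply/Scl; case: c'E => ->; [by left|right].
        by apply/fintype.subsetP => x; rewrite !mem_opp; exact: (fintype.subsetP ct).
      have := proper_card cst; rewrite ltnNge => /negP; apply.
      have -> : #|t| = #|S c'| by case: c'E => ->; rewrite ?(card_opp_set (@grid_revK m M)).
      have /Scl : closed_simplex c' `<=` closed_simplex c by rewrite (cmax _ cc').
      by case=> /subset_leq_card //; rewrite (card_opp_set (@grid_revK m M)).
    have [x xs px] := bichromatic true; have [y ys py] := bichromatic false.
    have [u ux] := b_surj_even x (grid_simplex_point sc xs) (introN idP (elimN eqP px)).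
    have sry : grid_simplex [set grid_rev y]%SET.
      by have := grid_simplex_opp (grid_simplex_point sc ys); rewrite /opp_set imset_set1.
    have [|v vy] := b_surj_even _ sry; first by rewrite parity_rev; case: (parity y) py.
    exists u, v; rewrite !vsE ux vy grid_revK xs ys orbT; split=> //.
    by rewrite /G ux vy grid_revK; exact: splxP sc xs ys.
- move=> [col colP]; pose v0 : grid := grid_corner 0.
  have sv0 : grid_simplex [set v0]%SET.
    have [j j0] := other_coordinate ord0.
    apply: (@grid_simplex_point [set v0; grid_inc v0 j]%SET); last by rewrite !inE eqxx.
    by apply: (@grid_simplex_inc _ ord0); rewrite 1?eq_sym// ?grid_cornerE//= ?box_M0//;
      left.
  have [u0 u0E] := b_surj v0 sv0.
  pose lies_over (u : vertex K) v := b u = v \/ b u = grid_rev v.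
  have over_inj (u u' : vertex K) v : lies_over u v -> lies_over u' v -> u = u'.
    move=> uv u'v; apply: b_inj; have := b_even u; have := b_even u'.
    by case: uv u'v => -> [->|->] //; rewrite parity_rev; case: parity.
  (* An edge of the path changes both the parity of the grid vertex and the colour of the vertex
     below it. The path ends over [u0] again, with the other parity. *)
  pose P v := grid_simplex [set v]%SET /\ forall u : vertex K, lies_over u v ->
    col u (+) parity v = col u0 (+) parity v0.
  have [] : P (grid_corner m.+1).
    apply: (grid_corner_walk); first by split=> // u uv; rewrite (over_inj _ _ _ uv u0E).
    move=> v j vj svw [sv Pv]; set w := grid_inc v j in svw *.
    have sw : grid_simplex [set w]%SET by apply: grid_simplex_point svw _;
      rewrite !inE eqxx orbT.
    split=> // u' u'w; have [u uv] := b_surj v sv; rewrite -(Pv u uv).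
    have pw : parity w = ~~ parity v by exact: parity_inc.
    have : col u != col u'.
      have := b_even u; have := b_even u'.
      case: uv => bu; case: u'w => bu'; rewrite bu bu' ?parity_rev pw ?negbK => p' p.
      + by rewrite p' in p.
      + by apply: colP; rewrite /G bu bu' grid_revK.
      + by rewrite eq_sym; apply: colP; rewrite /G bu bu' grid_revK finset.setUC.
      + by rewrite p in p'.
    by rewrite pw; case: (col u); case: (col u'); case: (parity v).
  rewrite grid_corner_rev => _ /(_ u0); rewrite parity_rev -/v0 /lies_over grid_revK.
  move=> h; have {h} := h (iffLR (or_comm _ _) u0E).
  by case: (col u0); case: (parity v0).
Qed.

End box_quadrangulation.

(** * Integer sequences attached to grid vertices *)

Section grid_labelling.
Variables (m r : nat) (M : 'I_m.+1 -> nat).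
Local Notation grid := (grid M).

Definition grid_seq (v : grid) (j : nat) : int :=
  if (j < m.+1)%N then (v (inord j) : nat)%:Z *+ 2 - (M (inord j))%:Z else 0.

Lemma grid_seq_support v j : (m.+1 <= j)%N -> grid_seq v j = 0.
Proof. by rewrite /grid_seq [(j < _)%N]ltnNge => ->. Qed.

Lemma grid_seq_alternates v d : (forall i, d < (M i)%:Z) -> grid_simplex [set v]%SET ->
  exists2 s, s = 1 \/ s = -1 & alternates d (grid_seq v) 1 s 0.
Proof.
move=> Md /and3P[_ _ /grid_facetP[i fi]]; have Mi := Md i.
have vE : grid_seq v i = (v i : nat)%:Z *+ 2 - (M i)%:Z by rewrite /grid_seq ltn_ord
  inord_val.
case: fi => /(_ v); rewrite inE eqxx => /(_ isT) vi; rewrite vi in vE.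
  by exists (-1); [right|exists (i : nat); split=> //; rewrite vE; lia].
by exists 1; [left|exists (i : nat); split=> //; rewrite vE; lia].
Qed.

(** Since [grid_rev v] is M - v, the sum is twice the difference of [u] and [grid_rev v], and a step
    changes a coordinate by at most 1. *)
Lemma grid_seq_close (u v : grid) j :
  grid_step u (grid_rev v) || grid_step (grid_rev v) u ->
  `|grid_seq u j + grid_seq v j| <= 2.
Proof.
rewrite /grid_seq; case: ifP => _; last by rewrite addr0 normr0.
move: (inord j : 'I_m.+1) => i.
by case/orP=> /grid_stepP/(_ i); have := grid_leM v i; rewrite grid_revE; lia.
Qed.

End grid_labelling.

Local Close Scope ring_scope.
Local Close Scope classical_set_scope.

Theorem theorem1p2 (R : realType) (k n : nat) (hk : 1 <= k) (hn : 2 * k < n) :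
  exists (K : cell_space R) (G : rel (vertex K)),
    [/\ generalised_simplicial_complex K,
        homeomorphic (underlying_space K) (projective_space R (n - 2 * k)),
        quadrangulation G,
        ~ bipartite G &
        exists f : vertex K -> schrijver_vertex n k,
          graph_hom G (@schrijver n k) f].
Proof.
pose r := (2 * k).-1; pose m := n - 2 * k.
have nE : m.+1 + r = n by rewrite /m /r; lia.
have m0 : 0 < m by rewrite /m subn_gt0.
pose d : int := (2 ^+ r)%R; have d0 : (0 <= d)%R by exact: exprn_ge0.
(* [N] exceeds the threshold needed before [r] differences and is at least 3. All sides are even
   except the one at [ord0], so their sum is odd. *)
pose N := `|(n%:Z ^+ r * d)%R| + 3.
pose M (i : 'I_m.+1) := N.*2 + (i == ord0).
have M3 i : 2 < M i by rewrite /M /N; lia.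
have M_odd : odd (\sum_i M i).
  by rewrite big_split/= sum_nat_const -big_mkcond big_pred1_eq oddD oddM odd_double andbF.
have [K [b /= [cK hK qK nbK bK]]] := box_quadrangulation_exists R m0 M3 M_odd.
exists K, (fun u v => grid_simplex [set b u; grid_rev (b v)]); split=> //.
pose y (v : grid M) := iter r diff (grid_seq v).
have y_supp v j : n <= j -> y v j = 0%R.
  by rewrite -nE; apply: iter_diff_support => ?; exact: grid_seq_support.
have lab_exists v : grid_simplex [set v] ->
    exists A : schrijver_vertex n k, forall j : 'I_n, j \in val A -> (d < y v j)%R.
  move=> sv; have [|s sE al] := grid_seq_alternates (d := (n%:Z ^+ r * d)%R) _ sv.
    by move=> i; rewrite /M /N; lia.
  apply: (stable_set_exists d0 (y_supp v) _ sE); first by lia.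
  have -> : k.*2 = (0 + r).+1 by rewrite /r; lia.
  apply: (alternates_iter_diff (L := m.+1)) al => //; first by rewrite nE.
  by move=> ?; exact: grid_seq_support.
have /boolp.choice[f fP] : forall u : vertex K, exists A : schrijver_vertex n k,
    forall j : 'I_n, j \in val A -> (d < y (b u) j)%R.
  by move=> u; exact/lab_exists/bK.
exists f => u v /and3P[_ /grid_chainP /(_ (b u) (grid_rev (b v))) uv _].
have {}uv : grid_step (b u) (grid_rev (b v)) || grid_step (grid_rev (b v)) (b u).
  by apply: uv; rewrite !inE eqxx ?orbT.
apply/pred0P => j /=; apply/negbTE/negP => /andP[/fP ju /fP jv].
(* A common element [j] of the two labels would make the sum of the entries exceed 2 * d, which is
   exactly the bound for the initial error 2. *)
have := iter_diff_bound r (fun j => grid_seq_close j uv) j.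
by rewrite -/(y _ _) -/(y _ _) -/d; lia.
Qed.
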